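(* Let $(A,\{\mu_k\}_{k\ge1})$ be an $A_\infty[1]$-algebra over a field of characteristic $0$ and $(M,\{\eta_k\}_{k\ge1})$ a bimodule over it. Then the graded vector space $\mathfrak a=\bigoplus_{n\in\mathbb Z}\mathrm{Hom}_n(\overline T(M),A)$ with the operations $$l_k(\theta_1,\ldots,\theta_k)=P[\cdots[[\triangle,\theta_1],\theta_2],\ldots,\theta_k],\quad k\ge1,\qquad \triangle=\sum_{k\ge1}(\mu_k+\eta_k),$$ is an $L_\infty[1]$-algebra. Moreover, this $L_\infty[1]$-algebra is weakly filtered, with filtration $\mathcal F_n(\mathfrak a)=\{\theta\in\mathfrak a:\theta|_{M^{\otimes i}}=0\text{ for }i<n\}$, $n\ge1$.
   Context: An $A_\infty[1]$-algebra is a graded vector space $A$ with degree $1$ maps $\mu_k:A^{\otimes k}\to A$, $k\ge1$, such that for all $n\ge1$, $\sum_{i+j=n+1}\sum_{\lambda=1}^j(-1)^{|a_1|+\cdots+|a_{\lambda-1}|}\mu_j(a_1,\ldots,a_{\lambda-1},\mu_i(a_\lambda,\ldots,a_{\lambda+i-1}),a_{\lambda+i},\ldots,a_n)=0$. A bimodule over it is a graded vector space $M$ with degree $1$ maps $\eta_k:\mathcal A^{k-1,1}\to M$, $k\ge1$, where $\mathcal A^{k-1,1}$ is the direct sum of all tensor products of $k-1$ copies of $A$ and one copy of $M$ in any order, satisfying the same identities whenever exactly one of $a_1,\ldots,a_n$ is in $M$ and the others in $A$, with $\mu_i$ or $\mu_j$ replaced by $\eta_i$ or $\eta_j$ when it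 has an argument in $M$. For a graded vector space $V$, $\overline T(V)=\bigoplus_{n\ge1}V^{\otimes n}$; $\mathrm{Hom}_n$ denotes degree $n$ linear maps; an element of $\mathrm{Hom}_n(\overline T(V),V)$ is a family $\mu=\sum_{k\ge1}\mu_k$ of degree $n$ maps $\mu_k:V^{\otimes k}\to V$. $\bigoplus_n\mathrm{Hom}_n(\overline T(V),V)$ is a graded Lie algebra with $[\mu_k,\gamma_l]=\mu_k\circ\gamma_l-(-1)^{mn}\gamma_l\circ\mu_k$ for $\mu$ of degree $m$, $\gamma$ of degree $n$, where $(\mu_k\circ\gamma_l)(v_1,\ldots,v_{k+l-1})=\sum_{i=1}^k(-1)^{n(|v_1|+\cdots+|v_{i-1}|)}\mu_k(v_1,\ldots,v_{i-1},\gamma_l(v_i,\ldots,v_{i+l-1}),\ldots,v_{k+l-1})$. Here $V=A\oplus M$, $L=\bigoplus_n\mathrm{Hom}_n(\overline T(A\oplus M),A\oplus M)$, maps on tensor products of copies of $A$ and $M$ are extended by zero, $\mathfrak a\subset L$, and $P:L\to\mathfrak a$ is the projection. An $L_\infty[1]$-algebra is a graded vector space $W$ with degree $1$ graded symmetric maps $l_k:W^{\otimes k}\to W$, $k\ge1$, with $\sum_{i+j=n+1}\sum_{\sigma\in S_{(i,n-i)}}\epsilon(\sigma)l_j(l_i(x_{\sigma(1)},\ldots,x_{\sigma(i)}),x_{\sigma(i+1)},\ldots,x_{\sigma(n)})=0$ for all $n\ge1$ ($S_{(i,n-i)}$: shuffles; $\epsilon(\sigma)$: Koszul sign). It is weakly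 filtered if equipped with a descending filtration $W=\mathcal F_1W\supset\mathcal F_2W\supset\cdots$ such that there is $n\ge1$ with $l_k(W,\ldots,W)\subset\mathcal F_kW$ for all $k\ge n$, and $W$ is complete: $W\cong\varprojlim W/\mathcal F_nW$ as graded vector spaces. *)

(* Defs.v *)
From HB Require Import structures.
From mathcomp Require Import all_boot all_order all_algebra all_fingroup.
From mathcomp Require Import boolp classical_sets functions cardinality fsbigop.
From mathcomp Require Import ring.
Set Implicit Arguments.
Unset Strict Implicit.
Unset Printing Implicit Defensive.
Import Order.TTheory GRing.Theory Num.Theory.
Local Open Scope classical_set_scope.
Local Open Scope ring_scope.

(* A graded vector space is a vector space V = \bigoplus_(d in Z) V_d, the
   decomposition being given by the projections [gpr d] of V onto V_d. *)
HB.mixin Record isGraded (K : fieldType) V of GRing.Lmodule K V := {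
  gpr : int -> V -> V;
  gpr_linear : forall d, linear (gpr d);
  gprK : forall d e (x : V), gpr d (gpr e x) = if d == e then gpr e x else 0;
  gpr_finite : forall x, finite_set [set d | gpr d x != 0];
  gpr_sum : forall x, x = \sum_(d \in [set: int]) gpr d x
}.

#[short(type="gradedSpace")]
HB.structure Definition Graded (K : fieldType) :=
  {V of isGraded K V & GRing.Lmodule K V}.

Section GradedTheory.
Variables (K : fieldType) (V : gradedSpace K).
Implicit Types (x y : V) (d e n : int).

HB.instance Definition _ d := GRing.isLinear.Build K V V _ (@gpr K V d)
  (@gpr_linear K V d).

Definition homog d x : bool := gpr d x == x.

Lemma gpr_homog d x : homog d (gpr d x).
Proof. by rewrite /homog gprK eqxx. Qed.

Lemma gpr_on d e x : homog d x -> gpr e x = if e == d then x else 0.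
Proof. by move=> /eqP xE; rewrite -xE gprK; case: eqP => // ->. Qed.

Lemma homog_lin d a x y : homog d x -> homog d y -> homog d (a *: x + y).
Proof. by move=> /eqP hx /eqP hy; rewrite /homog gpr_linear hx hy. Qed.

Lemma homog0 d : homog d (0 : V).
Proof. by rewrite /homog linear0. Qed.

Lemma homogZ d a x : homog d x -> homog d (a *: x).
Proof. by move=> hx; rewrite -[_ *: _]addr0 homog_lin ?homog0. Qed.

Lemma homogD d x y : homog d x -> homog d y -> homog d (x + y).
Proof. by move=> hx hy; rewrite -[x]scale1r homog_lin. Qed.

Lemma homog_sum d I (r : seq I) (F : I -> V) :
  (forall i, homog d (F i)) -> homog d (\sum_(i <- r) F i).
Proof.
move=> hF; elim/big_rec: _ => [|i x _]; first exact: homog0.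
exact: homogD.
Qed.

(* The operator x |-> (-1)^(n |x|) x, extended linearly to V. *)
Definition koszul n x : V :=
  \sum_(d \in [set: int]) (-1 : K) ^ (n * d) *: gpr d x.

Lemma koszulE (r : seq int) n x :
  uniq r -> (forall d, gpr d x != 0 -> d \in r) ->
  koszul n x = \sum_(d <- r) (-1 : K) ^ (n * d) *: gpr d x.
Proof.
move=> ur rx; rewrite /koszul (fsbigE r) //=.
  by apply: eq_bigl => i; rewrite in_setT.
move=> d _ dr; have [->|/rx] := eqVneq (gpr d x) 0; first by rewrite scaler0.
by rewrite (negPf dr).
Qed.

Lemma gpr_supp x : exists2 r : seq int, uniq r & forall d, gpr d x != 0 -> d \in r.
Proof.
have /finite_seqP [r rE] := gpr_finite x.
exists (undup r); first exact: undup_uniq.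
move=> d dx; rewrite mem_undup.
by have : [set d | gpr d x != 0] d by []; rewrite rE.
Qed.

Lemma koszul_linear n : linear (koszul n).
Proof.
move=> a x y.
have [r _ rx] := gpr_supp x; have [s _ sy] := gpr_supp y.
have ut := undup_uniq (r ++ s).
have tx d : gpr d x != 0 -> d \in undup (r ++ s).
  by move=> /rx; rewrite mem_undup mem_cat => ->.
have ty d : gpr d y != 0 -> d \in undup (r ++ s).
  by move=> /sy; rewrite mem_undup mem_cat orbC => ->.
rewrite !(@koszulE (undup (r ++ s))) //.
  rewrite scaler_sumr -big_split /=; apply: eq_bigr => d _.
  by rewrite gpr_linear scalerDr !scalerA mulrC.
move=> d; rewrite gpr_linear; apply: contraNT => dr.
have [->|/tx] := eqVneq (gpr d x) 0; last by rewrite (negPf dr).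
have [->|/ty] := eqVneq (gpr d y) 0; last by rewrite (negPf dr).
by rewrite scaler0 addr0.
Qed.

Lemma koszul_on n d x : homog d x -> koszul n x = (-1 : K) ^ (n * d) *: x.
Proof.
move=> hx; rewrite (@koszulE [:: d]) // ?big_seq1 ?(eqP hx) //.
by move=> e; rewrite (gpr_on _ hx) inE; case: (e == d) => //; rewrite eqxx.
Qed.

Definition homogs (ds : seq int) (s : seq V) : bool := all2 homog ds s.

End GradedTheory.

Section Pair.
Variables (K : fieldType) (A M : gradedSpace K).

Let pgpr d (x : (A * M)%type) : (A * M)%type := (gpr d x.1, gpr d x.2).

Fact pgpr_linear d : linear (pgpr d).
Proof. by move=> a x y; congr pair; rewrite /= gpr_linear. Qed.

Fact pgprK d e x : pgpr d (pgpr e x) = if d == e then pgpr e x else 0.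
Proof. by rewrite /pgpr /= !gprK; case: (d == e). Qed.

Fact pgpr_finite x : finite_set [set d | pgpr d x != 0].
Proof.
apply: sub_finite_set (_ : _ `<=`
  [set d | gpr d x.1 != 0] `|` [set d | gpr d x.2 != 0]) _.
  move=> d /= dx; have [x1|] := eqVneq (gpr d x.1) 0; last by left.
  have [x2|] := eqVneq (gpr d x.2) 0; last by right.
  by move: dx; rewrite /pgpr x1 x2 eqxx.
by rewrite finite_setU; split; apply: gpr_finite.
Qed.

Fact pgpr_sum x : x = \sum_(d \in [set: int]) pgpr d x.
Proof.
have /finite_seqP [r0 rE] := pgpr_finite x.
have ur := undup_uniq r0; set r := undup r0 in ur.
have hr d : d \notin r -> pgpr d x = 0.
  rewrite mem_undup => dr; apply/eqP; apply: contraNT dr => dx.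
  by have : [set d | pgpr d x != 0] d by []; rewrite rE.
rewrite (fsbigE r) //; last by move=> d _; apply: hr.
under eq_bigl do rewrite in_setT.
have e1 : (\sum_(i <- r) pgpr i x).1 = \sum_(i <- r) (pgpr i x).1.
  exact: (raddf_sum (@fst A M)).
have e2 : (\sum_(i <- r) pgpr i x).2 = \sum_(i <- r) (pgpr i x).2.
  exact: (raddf_sum (@snd A M)).
apply/eqP; rewrite -pair_eqE /pair_eq /= e1 e2 /=; apply/andP; split; apply/eqP.
  rewrite {1}[x.1]gpr_sum (fsbigE r) //; first by under eq_bigl do rewrite in_setT.
  by move=> d _ /hr [].
rewrite {1}[x.2]gpr_sum (fsbigE r) //; first by under eq_bigl do rewrite in_setT.
by move=> d _ /hr [].
Qed.

HB.instance Definition _ := isGraded.Build K (A * M)%type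
  pgpr_linear pgprK pgpr_finite pgpr_sum.

End Pair.

Section Hom.
Variables (K : fieldType) (V W : gradedSpace K).
Implicit Types (n : int).

(* A linear map out of \bigoplus_(k >= 1) V^{\otimes k} is given by one
   multilinear map per k >= 1, that is, by a function on nonempty lists; the
   value at the empty list is set to 0. *)
Definition multilin (f : seq V -> W) : Prop := forall s1 s2 a x y,
  f (s1 ++ (a *: x + y) :: s2) = a *: f (s1 ++ x :: s2) + f (s1 ++ y :: s2).

Definition is_Hom n (f : seq V -> W) : Prop :=
  [/\ f [::] = 0, multilin f &
      forall ds s, homogs ds s -> homog (\sum_(d <- ds) d + n) (f s)].

Lemma is_Hom0 n : is_Hom n 0.
Proof.
split=> // [s1 s2 a x y|ds s _]; last exact: homog0.
by rewrite /= scaler0 addr0.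
Qed.

Lemma is_Hom_lin n a (f g : seq V -> W) : is_Hom n f -> is_Hom n g -> is_Hom n (a *: f + g).
Proof.
move=> [f0 fl fd] [g0 gl gd]; have E s : (a *: f + g) s = a *: f s + g s by [].
split=> [|s1 s2 b x y|ds s h]; rewrite !E.
- by rewrite f0 g0 scaler0 addr0.
- rewrite fl gl !scalerDr !scalerA (mulrC a b).
  by rewrite -!addrA; congr (_ + _); rewrite addrCA.
- by apply: homog_lin; [apply: fd | apply: gd].
Qed.

Lemma multilin0 f s1 s2 : multilin f -> f (s1 ++ 0 :: s2) = 0.
Proof.
move=> fl; have := fl s1 s2 (-1) 0 0.
by rewrite scaler0 addr0 scaleN1r addNr.
Qed.

(* An element of \bigoplus_n Hom_n(V^{\otimes >= 1}, W), as the finitely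
   supported family of its components of each degree n. *)
Definition is_gHom (f : int -> seq V -> W) : Prop :=
  (forall n, is_Hom n (f n)) /\ finite_set [set n | f n <> 0].

Definition gHom_pred : {pred int -> seq V -> W} :=
  fun F => `[< is_gHom F >].

Fact gHom_submod : submod_closed gHom_pred.
Proof.
split=> [|a f g /asboolP [hf ff] /asboolP [hg fg]]; apply/asboolP; split.
- by move=> n; apply: is_Hom0.
- apply: sub_finite_set (_ : _ `<=` set0) (finite_set0 _).
  by move=> n /=; apply.
- by move=> n; apply: is_Hom_lin.
- apply: sub_finite_set (_ : _ `<=`
    [set n | f n <> 0] `|` [set n | g n <> 0]) _; last by rewrite finite_setU.
  move=> n /= h; apply/not_andP => -[f0 g0]; apply: h.
  have -> : (a *: f + g) n = a *: f n + g n by [].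
  by rewrite f0 g0 scaler0 addr0.
Qed.

HB.instance Definition _ := GRing.isSubmodClosed.Build K _ gHom_pred gHom_submod.

Record gHom := GHom {
  gHom_val :> int -> seq V -> W;
  gHom_valP : gHom_val \in gHom_pred }.

HB.instance Definition _ := [isSub for gHom_val].
HB.instance Definition _ := [Choice of gHom by <:].
HB.instance Definition _ := [SubChoice_isSubLmodule of gHom by <:].

Lemma gHomP (f : gHom) : is_gHom f.
Proof. by apply/asboolP; case: f. Qed.

Definition mkgHom F (FP : is_gHom F) : gHom := GHom (asboolT FP).

Definition single n (f : seq V -> W) : int -> seq V -> W := fun e => if e == n then f else 0.

Lemma singleP n f : is_Hom n f -> is_gHom (single n f).
Proof.
move=> fP; split=> [e|].
  by rewrite /single; case: eqP => [->|_] //; apply: is_Hom0.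
apply: sub_finite_set (_ : _ `<=` [set n]) (finite_set1 _) => e /=.
by rewrite /single; case: eqP.
Qed.

Definition gHom_pr n (f : gHom) : gHom := mkgHom (singleP (proj1 (gHomP f) n)).

Lemma gHom_ext (f g : gHom) : (forall n s, f n s = g n s) -> f = g.
Proof. by move=> fg; apply/val_inj/funext => n; apply/funext => s; apply: fg. Qed.

Implicit Types f g : gHom.

Fact gHom_pr_linear n : linear (gHom_pr n).
Proof.
move=> a f g; apply: gHom_ext => e s.
change (gHom_pr n (a *: f + g) e s = a *: gHom_pr n f e s + gHom_pr n g e s).
rewrite /= /single; case: ifP => // _.
by rewrite scaler0 addr0.
Qed.

Fact gHom_prK d e f : gHom_pr d (gHom_pr e f) = if d == e then gHom_pr e f else 0.
Proof.
apply: gHom_ext => n s; case: eqP => [->|de]; rewrite /= /single.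
  by rewrite eqxx; case: ifP.
by case: ifP => // _; case: eqP.
Qed.

Fact gHom_pr_supp (f : gHom) d : gHom_pr d f != 0 -> f d <> 0.
Proof.
apply: contra_neq_not => fd; apply: gHom_ext => e s /=; rewrite /single.
by case: eqP => //; rewrite fd.
Qed.

Fact gHom_pr_finite f : finite_set [set d | gHom_pr d f != 0].
Proof.
apply: sub_finite_set (proj2 (gHomP f)) => d; exact: gHom_pr_supp.
Qed.

Lemma gHom_sumE (r : seq int) (F : int -> gHom) n s :
  (\sum_(i <- r) F i : gHom) n s = \sum_(i <- r) F i n s.
Proof. by elim/big_rec2: _ => // i x y _ <-. Qed.

Fact gHom_pr_sum f : f = \sum_(d \in [set: int]) gHom_pr d f.
Proof.
have /finite_seqP [r0 rE] := gHom_pr_finite f.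
have ur := undup_uniq r0; set r := undup r0 in ur.
have hr d : d \notin r -> gHom_pr d f = 0.
  rewrite mem_undup => dr; apply/eqP; apply: contraNT dr => dx.
  by have : [set d | gHom_pr d f != 0] d by []; rewrite rE.
rewrite (fsbigE r) //; last by move=> d _; apply: hr.
under eq_bigl do rewrite in_setT.
apply: gHom_ext => n s; rewrite gHom_sumE.
have [nr|nr] := boolP (n \in r).
  rewrite (bigD1_seq n) //= big1 ?addr0; first by rewrite /single eqxx.
  by move=> i /negPf ni; rewrite /= /single eq_sym ni.
rewrite big_seq big1 => [|i ir].
  by have /(congr1 (fun g : gHom => g n s)) := hr _ nr; rewrite /= /single eqxx.
by rewrite /= /single; case: eqP => // ni; rewrite -ni (negPf nr) in ir.
Qed.

HB.instance Definition _ := isGraded.Build K gHom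
  gHom_pr_linear gHom_prK gHom_pr_finite gHom_pr_sum.

End Hom.

Section HomLemmas.
Variables (K : fieldType) (V W : gradedSpace K).

Lemma is_Hom_sum n I (r : seq I) (F : I -> seq V -> W) :
  (forall i, is_Hom n (F i)) -> is_Hom n (\sum_(i <- r) F i).
Proof.
move=> hF; elim/big_rec: _ => [|i x _ hx]; first exact: is_Hom0.
by rewrite -[F i]scale1r; apply: is_Hom_lin.
Qed.

Lemma homogs_cat d1 d2 (s1 s2 : seq V) :
  homogs d1 s1 -> homogs d2 s2 -> homogs (d1 ++ d2) (s1 ++ s2).
Proof.
by rewrite /homogs; elim: d1 s1 => [|d d1 ih] [|x s1] //= /andP[-> /ih h] /h ->.
Qed.

Lemma homogs_take i ds (s : seq V) : homogs ds s -> homogs (take i ds) (take i s).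
Proof.
rewrite /homogs; elim: ds s i => [|d ds ih] [|x s] [|i] //= /andP[-> /=].
exact: ih.
Qed.

Lemma homogs_drop i ds (s : seq V) : homogs ds s -> homogs (drop i ds) (drop i s).
Proof.
rewrite /homogs; elim: ds s i => [|d ds ih] [|x s] [|i] //= /andP[_]; exact: ih.
Qed.

Lemma homogs_koszul n ds (s : seq V) :
  homogs ds s -> homogs ds (map (koszul n) s).
Proof.
rewrite /homogs; elim: ds s => [|d ds ih] [|x s] //= /andP[hx /ih ->].
by rewrite (koszul_on _ hx) homogZ.
Qed.

Lemma homogs_nth p ds (s : seq V) :
  homogs ds s -> (p < size s)%N -> homog (nth 0 ds p) (nth 0 s p).
Proof.
rewrite /homogs; elim: ds s p => [|d ds ih] [|x s] [|p] //= /andP[hx hs] //.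
exact: ih.
Qed.

Lemma homogs_size ds (s : seq V) : homogs ds s -> size ds = size s.
Proof. by rewrite /homogs all2E => /andP[/eqP]. Qed.

Lemma take_ins i (s1 s2 : seq V) z : take i (s1 ++ z :: s2) =
  if (i <= size s1)%N then take i s1 else s1 ++ z :: take (i - (size s1).+1) s2.
Proof.
case: leqP => h; first exact: takel_cat.
rewrite take_cat ltnNge (ltnW h) /=.
by rewrite -[in LHS](@subnK 1 (i - size s1)) ?subn_gt0 // addn1 /= -subnDA addn1.
Qed.

Lemma drop_ins i (s1 s2 : seq V) z : drop i (s1 ++ z :: s2) =
  if (i <= size s1)%N then drop i s1 ++ z :: s2 else drop (i - (size s1).+1) s2.
Proof.
case: leqP => h; first by rewrite drop_cat; case: ltngtP h => // -> _;
  rewrite subnn drop_size.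
rewrite drop_cat ltnNge (ltnW h) /=.
by rewrite -[in LHS](@subnK 1 (i - size s1)) ?subn_gt0 // addn1 /= -subnDA addn1.
Qed.

End HomLemmas.

Section Bracket.
Variables (K : fieldType) (V : gradedSpace K).
Implicit Types (f g : seq V -> V) (m n : int).

(* f o g for g of degree n: on V^{\otimes N} with N = size s, the sum over
   k + l = N + 1 and i = 0..k-1 of f_k o g_l, with g_l inserted after the first
   i arguments; the sign (-1)^(n(|v_1| + ... + |v_i|)) is carried by the
   operators [koszul n] on these arguments. *)
Definition hcomp n f g : seq V -> V := fun s =>
  \sum_(1 <= l < (size s).+1) \sum_(0 <= i < (size s - l).+1)
    f (map (koszul n) (take i s) ++ g (take l (drop i s)) :: drop (i + l) s).

Lemma hcomp_term_multilin n f g i l : multilin f -> multilin g ->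
  multilin (fun s =>
    f (map (koszul n) (take i s) ++ g (take l (drop i s)) :: drop (i + l) s)).
Proof.
move=> fl gl s1 s2 a x y; rewrite !take_ins !drop_ins.
case: (leqP i (size s1)) => hi; last first.
  rewrite leqNgt (leq_trans hi (leq_addr _ _)) /=.
  by rewrite !map_cat /= koszul_linear -!catA /= fl.
rewrite !take_ins size_drop; case: (leqP l (size s1 - i)) => hl.
  have -> : (i + l <= size s1)%N by rewrite -leq_subRL.
  set u := map _ _ ++ _.
  have E z : map (koszul n) (take i s1) ++ g (take l (drop i s1)) ::
     (drop (i + l) s1 ++ z :: s2) =
     (map (koszul n) (take i s1) ++ g (take l (drop i s1)) :: drop (i + l) s1)
       ++ z :: s2 by rewrite -catA.
  by rewrite /u !E fl.
have -> : (i + l <= size s1)%N = false.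
  by apply/negbTE; rewrite -ltnNge -ltn_subLR.
by rewrite gl fl.
Qed.

Lemma hcomp_is_Hom m n f g : is_Hom m f -> is_Hom n g -> is_Hom (m + n) (hcomp n f g).
Proof.
move=> [_ fl fd] [_ gl gd]; split.
- by rewrite /hcomp big_nil.
- move=> s1 s2 a x y; rewrite /hcomp !size_cat /= scaler_sumr -big_split /=.
  apply: eq_bigr => l _; rewrite scaler_sumr -big_split /=.
  by apply: eq_bigr => i _; exact: (hcomp_term_multilin n i l fl gl s1 s2 a x y).
- move=> ds s h; rewrite /hcomp.
  apply: homog_sum => l; apply: homog_sum => i.
  have -> : \sum_(d <- ds) d + (m + n) =
    \sum_(d <- take i ds ++ (\sum_(e <- take l (drop i ds)) e + n)
                 :: drop (i + l) ds) d + m.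
    rewrite big_cat big_cons /= -{1}(cat_take_drop i ds) big_cat /=.
    rewrite -{1}(cat_take_drop l (drop i ds)) big_cat /= drop_drop (addnC l i).
    set u := \sum_(_ <- take i ds) _; set v := \sum_(_ <- take l _) _.
    set w := \sum_(_ <- drop _ _) _.
    ring.
  apply: fd; apply: homogs_cat.
    by apply: homogs_koszul; apply: homogs_take.
  apply/andP; split; last exact: homogs_drop.
  by apply: gd; apply: homogs_take; apply: homogs_drop.
Qed.

Lemma hcomp0l n g : hcomp n 0 g = 0.
Proof. by apply/funext => s; rewrite /hcomp big1 // => i _; rewrite big1. Qed.

Lemma hcomp0r n f : multilin f -> hcomp n f 0 = 0.
Proof.
move=> fl; apply/funext => s; rewrite /hcomp big1 // => l _; rewrite big1 // => i _.
exact: multilin0.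
Qed.

(* [f, g] for f of degree m and g of degree n *)
Definition hbracket m n f g : seq V -> V :=
  hcomp n f g - (-1 : K) ^ (m * n) *: hcomp m g f.

Lemma hbracket_is_Hom m n f g :
  is_Hom m f -> is_Hom n g -> is_Hom (m + n) (hbracket m n f g).
Proof.
move=> hf hg; rewrite /hbracket -scaleNr [X in is_Hom _ X]addrC; apply: is_Hom_lin.
  by rewrite addrC; apply: hcomp_is_Hom.
exact: hcomp_is_Hom.
Qed.

Implicit Types F G : gHom V V.

(* bilinear extension of [hbracket] to sums of homogeneous maps *)
Definition bracket_fun F G : int -> seq V -> V := fun e =>
  \sum_(m \in [set: int]) hbracket m (e - m) (F m) (G (e - m)).

Lemma bracket_funP F G : is_gHom (bracket_fun F G).
Proof.
have [hF fF] := gHomP F; have [hG fG] := gHomP G; split=> [e|].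
  apply: is_Hom_sum => m; have := hbracket_is_Hom (hF m) (hG (e - m)).
  by rewrite addrC subrK.
apply: sub_finite_set (_ : _ `<=`
  [set m + n | m in [set m | F m <> 0] & n in [set n | G n <> 0]]) _; last first.
  exact: finite_image2.
move=> e /= he; apply: contrapT => hn; apply: he.
apply: fsbig1 => m _; rewrite /hbracket.
have [F0|F0] := pselect (F m = 0).
  have [_ gl _] := hG (e - m).
  by rewrite F0 hcomp0l hcomp0r // scaler0 subr0.
have [G0|G0] := pselect (G (e - m) = 0).
  have [_ gl _] := hF m.
  by rewrite G0 hcomp0l hcomp0r // scaler0 subr0.
by case: hn; exists m => //; exists (e - m) => //; rewrite addrC subrK.
Qed.

Definition bracket F G : gHom V V := mkgHom (bracket_funP F G).

End Bracket.

Section Ainfinity.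
Variables (K : fieldType) (A : gradedSpace K).

(* [mu] restricted to lists of length k is mu_k; the sum runs over the length i
   of the inner operation and the number p = lambda - 1 of arguments before it. *)
Definition is_Ainf1 (mu : seq A -> A) : Prop :=
  is_Hom 1 mu /\
  forall ds s, homogs ds s ->
    \sum_(1 <= i < (size s).+1) \sum_(0 <= p < (size s - i).+1)
      (-1 : K) ^ (\sum_(d <- take p ds) d) *:
        mu (take p s ++ mu (take i (drop p s)) :: drop (p + i) s) = 0.

Variable M : gradedSpace K.

(* [eta l m r] is the value of eta_k, k = size l + 1 + size r, on the tensor
   product of the elements l of A, then m in M, then the elements r of A. In
   [bimod_rel] the three double sums collect the terms whose inner operation
   acts on a part of l, on a part containing m, and on a part of r. *)
Record is_bimodule (mu : seq A -> A) (eta : seq A -> M -> seq A -> M) : Prop := {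
  bimod_linl : forall m r, multilin (fun l => eta l m r);
  bimod_linm : forall l r, linear (fun m => eta l m r);
  bimod_linr : forall l m, multilin (eta l m);
  bimod_deg : forall dl l d m dr r, homogs dl l -> homog d m -> homogs dr r ->
    homog (\sum_(e <- dl) e + d + \sum_(e <- dr) e + 1) (eta l m r);
  bimod_rel : forall dl l d m dr r, homogs dl l -> homog d m -> homogs dr r ->
    \sum_(1 <= i < (size l).+1) \sum_(0 <= p < (size l - i).+1)
      (-1 : K) ^ (\sum_(e <- take p dl) e) *:
        eta (take p l ++ mu (take i (drop p l)) :: drop (p + i) l) m r
    + \sum_(0 <= p < (size l).+1) \sum_(0 <= q < (size r).+1)
      (-1 : K) ^ (\sum_(e <- take p dl) e) *:
        eta (take p l) (eta (drop p l) m (take q r)) (drop q r)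
    + \sum_(1 <= i < (size r).+1) \sum_(0 <= p < (size r - i).+1)
      (-1 : K) ^ (\sum_(e <- dl) e + d + \sum_(e <- take p dr) e) *:
        eta l m (take p r ++ mu (take i (drop p r)) :: drop (p + i) r)
    = 0
}.

End Ainfinity.

Section Linfinity.
Variables (K : fieldType) (W : gradedSpace K).

(* x_1 ... x_n = koszul_sign d sigma x_(sigma 1) ... x_(sigma n) in the graded
   symmetric algebra, for x_i of degree d_i *)
Definition koszul_sign n (d : 'I_n -> int) (sigma : 'S_n) : K :=
  \prod_(i < n) \prod_(j < n | (i < j)%N && (sigma j < sigma i)%N)
    (-1 : K) ^ (d (sigma i) * d (sigma j)).

(* sigma in S_(i, n - i) *)
Definition is_shuffle n (i : nat) (sigma : 'S_n) : bool :=
  [forall a : 'I_n, forall b : 'I_n,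
    [&& (a < b)%N & (b < i)%N || (i <= a)%N] ==> (sigma a < sigma b)%N].

Definition permuted n (x : 'I_n -> W) (sigma : 'S_n) : seq W :=
  [seq x (sigma i) | i <- enum 'I_n].

(* [l] restricted to lists of length k is l_k *)
Definition is_Linf1 (l : seq W -> W) : Prop :=
  [/\ is_Hom 1 l,
      forall n (d : 'I_n -> int) (x : 'I_n -> W) (sigma : 'S_n),
        (forall i, homog (d i) (x i)) ->
        l (permuted x sigma) = koszul_sign d sigma *: l (permuted x 1%g) &
      forall n (d : 'I_n -> int) (x : 'I_n -> W),
        (forall i, homog (d i) (x i)) ->
        \sum_(1 <= i < n.+1) \sum_(sigma : 'S_n | is_shuffle i sigma)
          koszul_sign d sigma *:
            l (l (take i (permuted x sigma)) :: drop i (permuted x sigma)) = 0].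

Definition coset (F : set W) (x : W) : set W := [set y | F (y - x)].

(* Degree d part of the inverse limit of the W / F_n W, n >= 1: compatible
   families (C_n) of cosets of F_n having a representative of degree d; the map
   W / F_(n+1) W -> W / F_n W sends a coset to the one containing it. *)
Definition invlim (F : nat -> set W) (d : int) : set (nat -> set W) :=
  [set C | (forall n, exists2 x, homog d x & C n = coset (F n.+1) x) /\
           (forall n, C n.+1 `<=` C n)].

(* [F n] is F_n W for n >= 1; [F 0] is irrelevant. *)
Record is_weakly_filtered (l : seq W -> W) (F : nat -> set W) : Prop := {
  wf_lin : forall n, (0 < n)%N ->
    F n 0 /\ forall a x y, F n x -> F n y -> F n (a *: x + y);
  wf_graded : forall n, (0 < n)%N -> forall d x, F n x -> F n (gpr d x);
  wf_desc : forall n, (0 < n)%N -> F n.+1 `<=` F n;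
  wf_top : F 1%N = [set: W];
  wf_brackets : exists2 n, (0 < n)%N &
    forall s : seq W, (n <= size s)%N -> F (size s) (l s);
  wf_complete : forall d,
    set_bij [set x | homog d x] (invlim F d) (fun x n => coset (F n.+1) x)
}.

End Linfinity.

Section DerivedBrackets.
Variables (K : fieldType) (A M : gradedSpace K).

Notation V := (A * M)%type.
Notation L := (gHom V V).
Notation frak_a := (gHom M A).

Lemma homogs_pair ds (s : seq V) :
  homogs ds s = homogs ds (map fst s) && homogs ds (map snd s).
Proof.
rewrite /homogs; elim: ds s => [|d ds ih] [|[x m] s] //=; rewrite ih.
have -> : homog d ((x, m) : V) = homog d x && homog d m by [].
by rewrite !andbA; congr (_ && _); rewrite -!andbA; congr (_ && _); rewrite andbC.
Qed.

Definition incl_fun (theta : frak_a) : int -> seq V -> V :=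
  fun n s => (theta n (map snd s), 0).

Lemma incl_funP theta : is_gHom (incl_fun theta).
Proof.
have [ht ft] := gHomP theta; split=> [n|].
  have [t0 tl td] := ht n; split=> [|s1 s2 a x y|ds s].
  - by rewrite /incl_fun t0.
  - rewrite /incl_fun !map_cat /= tl; congr pair.
    by rewrite /= scaler0 addr0.
  - rewrite homogs_pair => /andP[_ /td h].
    have -> : homog (\sum_(d <- ds) d + n) (incl_fun theta n s) =
      homog (\sum_(d <- ds) d + n) (theta n (map snd s)) &&
      homog (\sum_(d <- ds) d + n) (0 : M) by [].
    by rewrite h homog0.
apply: sub_finite_set ft => n /= h t0; apply: h.
by apply/funext => s; rewrite /incl_fun t0.
Qed.

Definition incl theta : L := mkgHom (incl_funP theta).

(* the projection P of L onto a: the component of maps from tensors of elements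
   of M to A *)
Definition proj_fun (phi : L) : int -> seq M -> A :=
  fun n s => (phi n (map (fun m => (0, m)) s)).1.

Lemma proj_funP phi : is_gHom (proj_fun phi).
Proof.
have [hf ff] := gHomP phi; split=> [n|].
  have [f0 fl fd] := hf n; split=> [|s1 s2 a x y|ds s h].
  - by rewrite /proj_fun f0.
  - rewrite /proj_fun !map_cat /=.
    have -> : (0, a *: x + y) = a *: ((0, x) : V) + (0, y).
      by congr pair; rewrite /= scaler0 addr0.
    by rewrite fl.
  - have : homogs ds (map (fun m => (0, m) : V) s).
      rewrite homogs_pair -!map_comp /= map_id h andbT.
      move: h; rewrite /homogs; elim: ds s => [|d ds ih] [|m s] //= /andP[_ /ih ->].
      by rewrite homog0.
    by move=> /fd /eqP /(congr1 fst) e; apply/eqP.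
apply: sub_finite_set ff => n /= h f0; apply: h.
by apply/funext => s; rewrite /proj_fun f0.
Qed.

Definition proj phi : frak_a := mkgHom (proj_funP phi).

Lemma inclK : cancel incl proj.
Proof.
by move=> t; apply: gHom_ext => n s; rewrite /= /proj_fun /= /incl_fun -map_comp map_id.
Qed.

Variables (mu : seq A -> A) (eta : seq A -> M -> seq A -> M).
Hypotheses (Amu : is_Ainf1 mu) (Meta : is_bimodule mu eta).

(* sum of the mu_k and eta_k extended by zero to A (+) M: expanding a tensor
   product of elements of A (+) M, the mu_k see the term with all factors in A,
   the eta_k the terms with exactly one factor, the p-th, in M *)
Definition triangle_fun (s : seq V) : V :=
  (mu (map fst s),
   \sum_(0 <= p < size s)
     eta (map fst (take p s)) (nth 0 s p).2 (map fst (drop p.+1 s))).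

Lemma triangle_is_Hom : is_Hom 1 triangle_fun.
Proof.
have [[m0 ml md] _] := Amu; split=> [|s1 s2 a x y|ds s h].
- by rewrite /triangle_fun m0 big_nil.
- rewrite /triangle_fun; congr pair; rewrite /=; first by rewrite !map_cat /= ml.
  rewrite !size_cat /= scaler_sumr -big_split /=; apply: eq_big_nat => p _.
  rewrite !take_ins !drop_ins !nth_cat; case: (ltngtP p (size s1)) => hp.
  + by rewrite !map_cat /= (bimod_linr Meta).
  + have -> : (p - size s1)%N = (p - (size s1).+1).+1 by rewrite subnSK.
    by rewrite !map_cat /= (bimod_linl Meta).
  + by rewrite hp subnn /= (bimod_linm Meta).
- have := h; rewrite homogs_pair => /andP[h1 h2].
  have : homog (\sum_(d <- ds) d + 1) (triangle_fun s).1 by apply: md.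
  have : homog (\sum_(d <- ds) d + 1) (triangle_fun s).2.
    rewrite /triangle_fun /= big_nat_cond [X in homog _ X]big_mkcond /=.
    apply: homog_sum => p; case: ifP => [/andP[hp _]|_]; last exact: homog0.
    have -> : \sum_(d <- ds) d = \sum_(d <- take p ds) d + nth 0 ds p
        + \sum_(d <- drop p.+1 ds) d.
      rewrite -{1}(cat_take_drop p ds) big_cat /= (drop_nth 0) ?big_cons ?addrA //.
      by rewrite (homogs_size h).
    rewrite map_take map_drop; apply: (bimod_deg Meta).
    + exact: homogs_take.
    + by have := @homogs_nth _ _ p _ _ h2; rewrite size_map (nth_map 0) // => ->.
    + exact: homogs_drop.
  by move=> /eqP e2 /eqP e1; apply/eqP/(congr2 pair e1 e2).
Qed.

Definition triangle : L := mkgHom (singleP triangle_is_Hom).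

(* l_k on lists of length k >= 1; at the empty list the value is P triangle = 0 *)
Definition derived_bracket (thetas : seq frak_a) : frak_a :=
  proj (foldl (@bracket K V) triangle (map incl thetas)).

Definition arity_filtration (n : nat) : set frak_a :=
  [set theta | forall e (s : seq M), (size s < n)%N -> theta e s = 0].

End DerivedBrackets.

(* Main.v *)
(* Inserting a map into the arguments of another one is a graded right pre-Lie
   product: the failure of associativity only collects the insertions of two
   maps into disjoint blocks, which is symmetric up to sign. Hence the bracket on
   L satisfies the graded Jacobi identity, and the relations of the algebra and
   of the bimodule say exactly that [triangle, triangle] = 0.

   The rest is Voronov's higher derived bracket argument. Expand
   P [..[[triangle, triangle], x_1], .., x_n] = 0 by the Leibniz rule as a sum of
   P [triangle_S, triangle_S'] over splittings of the arguments. As a is abelian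
   and ker P is a subalgebra, P [X, Y] = P [P X, Y] + P [X, P Y], and each of the
   two terms sums up to the n-th L-infinity relation, so twice it vanishes.

   For the filtration, give weight 1 to M and 0 to A: the excess of the weight of
   the arguments over that of the value is additive under insertion, is at least
   0 for triangle and at least 1 for the elements of a. *)

Require Import Defs.
From HB Require Import structures.
From mathcomp Require Import all_boot all_order all_algebra all_fingroup.
From mathcomp Require Import boolp classical_sets functions cardinality fsbigop.
From mathcomp Require Import ring zify.
Set Implicit Arguments.
Unset Strict Implicit.
Unset Printing Implicit Defensive.
Import GRing.Theory.
Local Open Scope ring_scope.

(** * Signs and linear maps *)

Section Signs.
Variable K : fieldType.
Implicit Types m n : int.

Definition sg m : K := (-1) ^ m.

Lemma sgD m n : sg (m + n) = sg m * sg n.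
Proof. by rewrite /sg expfzDr // oppr_eq0 oner_eq0. Qed.

Lemma sg0 : sg 0 = 1. Proof. by []. Qed.

Lemma sg1 : sg 1 = -1. Proof. by []. Qed.

Lemma sgP m : sg m = 1 \/ sg m = -1.
Proof.
have sgn k : (-1 : K) ^+ k = 1 \/ (-1 : K) ^+ k = -1.
  by rewrite -signr_odd; case: odd; [right | left].
case: m => k; rewrite /sg; first exact: sgn.
by have -> : (-1 : K) ^ Negz k = ((-1) ^+ k.+1)^-1 by []; case: (sgn k.+1) => ->;
  rewrite ?invrN invr1; [left | right].
Qed.

Lemma sgK m : sg m * sg m = 1.
Proof. by case: (sgP m) => ->; rewrite ?mulrNN mulr1. Qed.

End Signs.

Arguments sg {K} m.

Section LinearFun.
Variables (K : fieldType) (U V : lmodType K) (f : U -> V).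
Hypothesis fl : linear f.

Let fL : {linear U -> V} := HB.pack f (GRing.isLinear.Build K U V _ f fl).

Lemma lin0 : f 0 = 0. Proof. exact: (raddf0 fL). Qed.
Lemma linD x y : f (x + y) = f x + f y. Proof. exact: (raddfD fL). Qed.
Lemma linB x y : f (x - y) = f x - f y. Proof. exact: (raddfB fL). Qed.
Lemma linZ a x : f (a *: x) = a *: f x. Proof. exact: (linearZ_LR fL). Qed.
Lemma lin_sum I (r : seq I) (Q : pred I) F :
  f (\sum_(i <- r | Q i) F i) = \sum_(i <- r | Q i) f (F i).
Proof. exact: (raddf_sum fL). Qed.

End LinearFun.

(** * Splittings of a list into two complementary subsequences *)

Section Splits.
Variable T : eqType.
Implicit Types (s t u v : seq T) (p : seq T * seq T).

(** Each entry goes to one side or the other, as each argument goes to one factor under the Leibniz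
    rule; the splittings of an increasing list stand for the shuffles of all sizes. *)
Fixpoint splits t : seq (seq T * seq T) :=
  if t is a :: t' then
    [seq (a :: p.1, p.2) | p <- splits t'] ++ [seq (p.1, a :: p.2) | p <- splits t']
  else [:: ([::], [::])].

Lemma mem_splits_perm t p : p \in splits t -> perm_eq (p.1 ++ p.2) t.
Proof.
elim: t p => [|a t ih] p /=; first by rewrite inE => /eqP ->.
rewrite mem_cat => /orP[] /mapP[q /ih qt ->] /=; first by rewrite perm_cons.
by rewrite (perm_catCA _ [:: a]) /= perm_cons.
Qed.

Lemma mem_splits_subseq t p : p \in splits t -> subseq p.1 t && subseq p.2 t.
Proof.
elim: t p => [|a t ih] p; first by rewrite inE => /eqP ->.
rewrite [splits _]/= mem_cat => /orP[] /mapP[q /ih /andP[q1 q2] ->]; apply/andP; split.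
- by rewrite /= eqxx.
- exact: subseq_trans q2 (subseq_cons t a).
- exact: subseq_trans q1 (subseq_cons t a).
- by rewrite /= eqxx.
Qed.

Lemma splits_uniq t : uniq t -> uniq (splits t).
Proof.
elim: t => //= a t ih /andP[at_ /ih ut].
rewrite cat_uniq !map_inj_uniq ?ut /= ?andbT.
- apply/hasPn => _ /mapP[q qt ->]; apply/mapP => -[q' _ [q1 _]].
  have /perm_mem/(_ a) := mem_splits_perm qt.
  by rewrite mem_cat q1 inE eqxx (negPf at_).
- by move=> [u v] [u' v'] [-> ->].
- by move=> [u v] [u' v'] [-> ->].
Qed.

Lemma splits_swap t : perm_eq [seq (p.2, p.1) | p <- splits t] (splits t).
Proof.
elim: t => //= a t ih; rewrite map_cat -!map_comp.
rewrite (eq_map (_ : _ =1 (fun p => (p.1, a :: p.2)) \o (fun p => (p.2, p.1)))) //.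
rewrite [X in _ ++ X](eq_map (_ : _ =1 (fun p => (a :: p.1, p.2)) \o
  (fun p => (p.2, p.1)))) //.
by rewrite perm_catC 2![map (_ \o _) _]map_comp; apply: perm_cat; apply: perm_map.
Qed.

Lemma mem_splits (r : rel T) t u v : irreflexive r -> transitive r -> sorted r t ->
  sorted r u -> sorted r v -> perm_eq (u ++ v) t -> (u, v) \in splits t.
Proof.
move=> rI rT; elim: t u v => [|a t ih] u v.
  by move=> _ _ _ /perm_size; rewrite size_cat; case: u v => [|? ?] [|? ?].
move=> st su sv uvt; have := st; rewrite /= (path_sortedE rT) => /andP[/allP art st'].
have amem : a \in u ++ v by rewrite (perm_mem uvt) inE eqxx.
(* The head [a] of [t] is its least entry, hence the first entry of whichever sorted part contains
   it. *)
have headE b s : sorted r (b :: s) -> a \in b :: s ->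
    {subset b :: s <= a :: t} -> b = a.
  rewrite /= (path_sortedE rT) => /andP[/allP bs _].
  rewrite inE => /orP[/eqP//|/bs ba] /(_ b); rewrite inE eqxx => /(_ isT).
  rewrite inE => /orP[/eqP//|/art ab].
  by have := rT _ _ _ ab ba; rewrite rI.
have uS : {subset u <= a :: t} by move=> x xu; rewrite -(perm_mem uvt) mem_cat xu.
have vS : {subset v <= a :: t}.
  by move=> x xv; rewrite -(perm_mem uvt) mem_cat xv orbT.
have tl s b : sorted r (b :: s) -> sorted r s.
  by rewrite /= (path_sortedE rT) => /andP[].
rewrite /= mem_cat; move: amem; rewrite mem_cat => /orP[au|av]; apply/orP.
- case: u su uvt au uS => // b u su uvt au /(headE _ _ su au) bE; subst b.
  left; apply/mapP; exists (u, v) => //; apply: ih => //.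
    exact: (tl _ _ su).
  by move: uvt; rewrite /= perm_cons.
- case: v sv uvt av vS => // b v sv uvt av /(headE _ _ sv av) bE; subst b.
  right; apply/mapP; exists (u, v) => //; apply: ih => //.
    exact: (tl _ _ sv).
  by move: uvt; rewrite (perm_catCA _ [:: a]) /= perm_cons.
Qed.

End Splits.

(* The sign of a list of indices as a rearrangement of the sorted list. *)
Section ListSign.
Variables (K : fieldType) (n : nat) (d : 'I_n -> int).
Implicit Types (a b : 'I_n) (t u v : seq 'I_n).

Local Notation deg t := (\sum_(i <- t) d i).

Fixpoint list_sign t : K :=
  if t is a :: t' then
    (\prod_(b <- t' | (b < a)%N) sg (d a * d b)) * list_sign t'
  else 1.

(** Only inversions across the two blocks are counted; for increasing [u] and [v] these are all the
    inversions of [u ++ v]. *)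
Definition pair_sign u v : K :=
  \prod_(a <- u) \prod_(b <- v | (b < a)%N) sg (d a * d b).

Lemma sg_degr (m : int) t : sg (m * deg t) = \prod_(b <- t) sg (m * d b) :> K.
Proof.
elim: t => [|b t ih]; first by rewrite !big_nil mulr0.
by rewrite !big_cons mulrDr sgD ih.
Qed.

Local Notation incr := (sorted (fun i j : 'I_n => (i < j)%N)).

Lemma incr_cons a t : incr (a :: t) = all (fun b : 'I_n => a < b)%N t && incr t.
Proof. by rewrite /= path_sortedE // => i j k; apply: ltn_trans. Qed.

Lemma list_sign_incr t : incr t -> list_sign t = 1.
Proof.
elim: t => // a t ih; rewrite incr_cons => /andP[/allP at_ /ih tE].
rewrite [LHS]/= tE mulr1 big_seq_cond big_pred0 // => b; apply/negP => /andP[/at_].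
by case: ltngtP.
Qed.

Lemma list_sign_cat u v : incr u -> incr v -> list_sign (u ++ v) = pair_sign u v.
Proof.
move=> + /list_sign_incr v1; elim: u => [|a u ih].
  by move=> _; rewrite /pair_sign big_nil.
rewrite incr_cons => /andP[/allP au /ih uv]; rewrite /= uv.
rewrite /pair_sign big_cons big_cat /= big_seq_cond big_pred0 ?mul1r // => b.
by apply/negP => /andP[/au]; case: ltngtP.
Qed.

Lemma pair_sign_consr a u v : all (fun b : 'I_n => a < b)%N u ->
  pair_sign u (a :: v) = sg (d a * deg u) * pair_sign u v.
Proof.
move=> /allP au; rewrite sg_degr /pair_sign -big_split /= !big_seq.
by apply: eq_bigr => b /au ab; rewrite big_cons ab [d b * _]mulrC.
Qed.

Lemma pair_sign_consl a u v : all (fun b : 'I_n => a < b)%N v ->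
  pair_sign (a :: u) v = pair_sign u v.
Proof.
move=> /allP av; rewrite /pair_sign big_cons big_seq_cond big_pred0 ?mul1r // => b.
by apply/negP => /andP[/av]; case: ltngtP.
Qed.

(** Two distinct indices, one from each list, form an inversion in exactly one of the two orders, so
    the product runs over all pairs. *)
Lemma pair_signC u v : uniq (u ++ v) ->
  pair_sign u v * pair_sign v u = sg (deg u * deg v).
Proof.
elim: u => [|a u ih] /=.
  move=> _; rewrite /pair_sign !big_nil mul0r sg0 mul1r big1 // => b _.
  by rewrite big_nil.
rewrite mem_cat negb_or => /andP[/andP[au av] /ih uv].
rewrite big_cons mulrDl sgD -uv [pair_sign (a :: u) v]/pair_sign big_cons.
have -> : pair_sign v (a :: u) =
    (\prod_(b <- v | (a < b)%N) sg (d a * d b)) * pair_sign v u.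
  rewrite /pair_sign [X in X * _]big_mkcond -big_split /=.
  apply: eq_bigr => b _; rewrite big_cons; case: ifP => _; last by rewrite mul1r.
  by rewrite [d b * d a]mulrC.
rewrite mulrACA; congr (_ * _).
rewrite sg_degr [LHS]mulrC [RHS](bigID (fun b : 'I_n => (a < b)%N)) /=.
congr (_ * _); rewrite big_seq_cond [RHS]big_seq_cond; apply: eq_bigl => b.
case bv : (b \in v) => //=; rewrite -leqNgt ltn_neqAle; case: eqP => //.
by move=> /val_inj ba; rewrite ba (negPf av) in bv.
Qed.

End ListSign.

Lemma koszul_sign_list (K : fieldType) n (d : 'I_n -> int) (s : 'S_n) :
  koszul_sign K d s = list_sign K d (map s (enum 'I_n)).
Proof.
rewrite /koszul_sign -/sg.
(* Dropping the first index of a permutation does not leave a permutation, so the induction runs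
   over all maps ['I_m -> 'I_n]. *)
suff H m (f : 'I_m -> 'I_n) : \prod_(i < m) \prod_(j < m | (i < j)%N && (f j < f i)%N)
    sg (d (f i) * d (f j)) = list_sign K d (map f (enum 'I_m)) by exact: H.
elim: m f => [|m ih] f; first by rewrite big_ord0 enum_ord0.
rewrite big_ord_recl enum_ordSl /= -map_comp -ih; congr (_ * _).
  rewrite big_map big_enum_cond /= big_mkcond big_ord_recl /= mul1r -big_mkcond /=.
  by apply: eq_bigl => j.
apply: eq_bigr => i _; rewrite big_mkcond big_ord_recl /= mul1r -big_mkcond /=.
by apply: eq_bigl => j; rewrite /bump /= !add1n ltnS.
Qed.

(** * Shuffles as splittings of the list of indices *)

Section Shuffles.
Variable n : nat.
Local Notation enum_n := (enum 'I_n).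

Lemma ord_enum_incr : sorted (fun i j : 'I_n => (i < j)%N) enum_n.
Proof. by have := iota_ltn_sorted 0 n; rewrite -val_enum_ord sorted_map. Qed.

Lemma is_shuffleP i (s : 'S_n) : is_shuffle i s =
  sorted (fun i j : 'I_n => (i < j)%N) (take i (map s enum_n)) &&
  sorted (fun i j : 'I_n => (i < j)%N) (drop i (map s enum_n)).
Proof.
have tr : transitive (fun i j : 'I_n => (i < j)%N) by move=> ? ? ?; apply: ltn_trans.
have sz : size (map s enum_n) = n by rewrite size_map size_enum_ord.
apply/idP/andP.
  move=> /forallP sh; have {}sh (a b : 'I_n) : (a < b)%N ->
    (b < i)%N || (i <= a)%N -> (s a < s b)%N.
    by move=> ab abi; have /forallP/(_ b) := sh a; rewrite ab abi.
  case: n s sh sz {tr} => [s _|m s sh sz]; first by rewrite enum_ord0; case: (i).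
  have nthE k : (k < m.+1)%N ->
      nth (s ord0) (map s (enum 'I_m.+1)) k = s (inord k).
    move=> km; rewrite (nth_map ord0) ?size_enum_ord //; congr (s _).
    by apply: ord_inj; rewrite nth_enum_ord // inordK.
  split; apply/(sortedP (s ord0)) => k.
    rewrite size_take_min sz leq_min => /andP[ki km].
    rewrite !nth_take ?(ltnW ki) // !nthE ?(ltnW km) //.
    by apply: sh; rewrite !inordK ?(ltnW km) ?ki.
  rewrite size_drop sz ltn_subRL addnS => km.
  rewrite !nth_drop addnS !nthE ?(ltnW km) //.
  by apply: sh; rewrite !inordK ?(ltnW km) ?leq_addr ?orbT.
rewrite !sorted_pairwise // => -[/(pairwiseP (s _)) p1 /(pairwiseP (s _)) p2].
apply/forallP => a; apply/forallP => b; apply/implyP => /andP[ab abi].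
have nthE (k : 'I_n) : nth (s a) (map s enum_n) k = s k.
  by rewrite (nth_map a) ?size_enum_ord // nth_ord_enum.
case/orP: abi => abi.
  have ai := ltn_trans ab abi.
  have := p1 a a b; rewrite !nth_take // !nthE !inE size_take_min sz !leq_min.
  by rewrite ai abi !ltn_ord; apply.
have ib := leq_trans abi (ltnW ab).
have := p2 a (a - i)%N (b - i)%N; rewrite !inE size_drop sz !nth_drop !subnKC //.
by rewrite !nthE; apply; rewrite ?ltn_sub2r ?ltn_sub2rE // (leq_ltn_trans abi).
Qed.

(** Cutting the list of values of a shuffle at [i] is a bijection onto the splittings whose first
    part has length [i]. *)
Lemma sum_shuffles (V : nmodType) (F : seq 'I_n -> seq 'I_n -> V) i : (i <= n)%N ->
  \sum_(s : 'S_n | is_shuffle i s) F (take i (map s enum_n)) (drop i (map s enum_n))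
  = \sum_(p <- splits enum_n | size p.1 == i) F p.1 p.2.
Proof.
move=> i_n; pose h (s : 'S_n) := (take i (map s enum_n), drop i (map s enum_n)).
rewrite -[RHS]big_filter -[LHS]big_filter.
rewrite -(big_map h xpredT (fun p => F p.1 p.2)); apply: perm_big.
have tr : transitive (fun i j : 'I_n => (i < j)%N) by move=> ? ? ?; apply: ltn_trans.
have ir : irreflexive (fun i j : 'I_n => (i < j)%N) by move=> ?; apply: ltnn.
have permE (s : 'S_n) : perm_eq (map s enum_n) enum_n.
  apply: uniq_perm; [by rewrite (map_inj_uniq (@perm_inj _ s)) enum_uniq | |].
    exact: enum_uniq.
  by move=> x; rewrite mem_enum -[x](permKV s) (mem_map (@perm_inj _ s)) mem_enum.
apply: uniq_perm.
- rewrite map_inj_in_uniq ?filter_uniq ?index_enum_uniq // => s s' _ _ [h1 h2].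
  have : map s enum_n = map s' enum_n.
    by rewrite -(cat_take_drop i (map s _)) h1 h2 cat_take_drop.
  by move=> /eq_in_map ss; apply/permP => x; apply: ss; rewrite mem_enum.
- by rewrite filter_uniq // splits_uniq // enum_uniq.
move=> [u v]; rewrite mem_filter /=; apply/mapP/andP.
  move=> [s]; rewrite mem_filter is_shuffleP => /andP[/andP[s1 s2] _] [-> ->].
  rewrite size_takel; last by rewrite size_map size_enum_ord.
  split=> //.
  by apply: (mem_splits ir tr ord_enum_incr s1 s2); rewrite cat_take_drop.
(* Surjectivity: the two parts joined rearrange ['I_n], hence form the list of values of a
   permutation. *)
move=> [/eqP su uv]; have := mem_splits_perm uv => /= uvE.
have /andP[/= su1 sv1] := mem_splits_subseq uv.
have : perm_eq (u ++ v) (ord_tuple n) by exact: uvE.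
move=> /tuple_permP[s sE].
have {}sE : u ++ v = map s enum_n.
  by rewrite sE; apply: eq_map => j; rewrite tnth_ord_tuple.
have E : h s = (u, v) by rewrite /h -sE -su take_size_cat // drop_size_cat.
exists s => //; rewrite mem_filter mem_index_enum andbT is_shuffleP.
case: E => -> ->; rewrite (subseq_sorted tr su1 ord_enum_incr).
by rewrite (subseq_sorted tr sv1 ord_enum_incr).
Qed.

End Shuffles.

(** * Higher derived brackets *)

Section DerivedLinf.
Variables (K : fieldType) (L W : gradedSpace K).
Variables (br : L -> L -> L) (I : W -> L) (P : L -> W) (D : L).
Implicit Types (X Y Z : L) (p q e : int) (a b : W).

(** Voronov's data: a graded Lie algebra, an abelian subalgebra, a projection onto it whose kernel
    is a subalgebra, and a square-zero element of degree 1 in that kernel. The Jacobi identity is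
    put in the form that bracketing with [Z] is a right derivation. *)
Hypothesis br_linl : forall Y, linear (br^~ Y).
Hypothesis br_linr : forall X, linear (br X).
Hypothesis br_homog : forall p q X Y,
  homog p X -> homog q Y -> homog (p + q) (br X Y).
Hypothesis br_anti : forall p q X Y, homog p X -> homog q Y ->
  br X Y = - (sg (p * q) *: br Y X).
Hypothesis br_leibniz : forall p q e X Y Z, homog p X -> homog q Y -> homog e Z ->
  br (br X Y) Z = br X (br Y Z) + sg (q * e) *: br (br X Z) Y.
Hypothesis I_lin : linear I.
Hypothesis P_lin : linear P.
Hypothesis I_homog : forall p a, homog p a -> homog p (I a).
Hypothesis P_homog : forall p X, homog p X -> homog p (P X).
Hypothesis IK : cancel I P.
Hypothesis I_abelian : forall a b, br (I a) (I b) = 0.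
Hypothesis P_ker : forall X Y, P X = 0 -> P Y = 0 -> P (br X Y) = 0.
Hypothesis D_homog : homog 1 D.
Hypothesis D_square : br D D = 0.
Hypothesis PD : P D = 0.

Definition nest X (s : seq W) : L := foldl br X (map I s).

Lemma nest_cat X s t : nest X (s ++ t) = nest (nest X s) t.
Proof. by rewrite /nest map_cat foldl_cat. Qed.

Lemma nest_lin s : linear (nest^~ s).
Proof.
elim: s => [|z s ih] // a X Y; rewrite /nest /= br_linl; exact: ih.
Qed.

Lemma nest_multilin X : multilin (nest X).
Proof.
move=> s1 s2 a x y; rewrite !nest_cat /= /nest /= I_lin br_linr; exact: nest_lin.
Qed.

Lemma nest_homog p X ds s :
  homog p X -> homogs ds s -> homog (p + \sum_(d <- ds) d) (nest X s).
Proof.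
elim: s ds p X => [|z s ih] [|d ds] // p X hX; first by rewrite big_nil addr0.
move=> /andP[hz hs]; rewrite big_cons addrA /nest /=; apply: ih => //.
by apply: br_homog => //; apply: I_homog.
Qed.

(** As the image of [I] is abelian, the Leibniz rule leaves only the term with the two arguments
    exchanged. *)
Lemma nest_swap p q e X a b s : homog p X -> homog q a -> homog e b ->
  nest X (a :: b :: s) = sg (q * e) *: nest X (b :: a :: s).
Proof.
move=> hX ha hb; rewrite /nest /= -!/(nest _ s).
rewrite (br_leibniz hX (I_homog ha) (I_homog hb)) I_abelian (lin0 (br_linr X)) add0r.
by rewrite (linZ (nest_lin s)).
Qed.

Lemma nest_rcons p e X ds s z : homog p X -> homogs ds s -> homog e z ->
  nest X (rcons s z) = sg ((\sum_(d <- ds) d) * e) *: nest X (z :: s).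
Proof.
elim: s ds p X => [|y s ih] [|d ds] // p X hX.
  by rewrite big_nil mul0r sg0 scale1r.
move=> /andP[hy hs] hz; rewrite [LHS]/nest rcons_cons /=.
rewrite -/(nest _ _) (ih ds (p + d)) //; last by apply: br_homog => //; apply: I_homog.
rewrite -[nest _ (z :: s)]/(nest X (y :: z :: s)) (nest_swap _ hX hy hz).
rewrite scalerA -sgD big_cons mulrDl.
by rewrite addrC.
Qed.

Definition derived s : W := P (nest D s).

(** * Iterated brackets over a family of homogeneous elements *)

Section Family.
Variables (n : nat) (d : 'I_n -> int) (x : 'I_n -> W).
Hypothesis hx : forall i, homog (d i) (x i).
Implicit Types t u v : seq 'I_n.

Local Notation deg t := (\sum_(i <- t) d i).
Local Notation incr := (sorted (fun i j : 'I_n => (i < j)%N)).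

Lemma homogs_fam t : homogs (map d t) (map x t).
Proof. by rewrite /homogs; elim: t => //= i t ->; rewrite hx. Qed.

Lemma nest_fam_homog p X t : homog p X -> homog (p + deg t) (nest X (map x t)).
Proof. by move=> hX; have := nest_homog hX (homogs_fam t); rewrite big_map. Qed.

Lemma nest_fam_rcons p e X t z : homog p X -> homog e z ->
  nest X (rcons (map x t) z) = sg (deg t * e) *: nest X (z :: map x t).
Proof. by move=> hX hz; rewrite (nest_rcons hX (homogs_fam t) hz) big_map. Qed.

Lemma nest_sort p X t u : homog p X -> incr u -> perm_eq t u ->
  nest X (map x t) = list_sign K d t *: nest X (map x u).
Proof.
elim: t u p X => [|i t ih] u p X hX iu.
  by rewrite perm_sym => /perm_nilP ->; rewrite scale1r.
move=> tu; have : i \in u by rewrite -(perm_mem tu) inE eqxx.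
move=> /splitPr uE; case: u / uE iu tu => u v iu tu.
have {}tu : perm_eq t (u ++ v).
  by move: tu; rewrite perm_sym (perm_catCA _ [:: i]) /= perm_cons perm_sym.
have tr : transitive (fun i j : 'I_n => (i < j)%N) by move=> ? ? ?; apply: ltn_trans.
have iuv : incr (u ++ v).
  by apply: subseq_sorted iu => //; rewrite cat_subseq // subseq_cons.
have hXi : homog (p + d i) (br X (I (x i))) by apply: br_homog => //; apply: I_homog.
rewrite [LHS](ih _ _ _ hXi iuv tu) /= mulrC -scalerA; congr (_ *: _).
rewrite -[nest _ _]/(nest X (x i :: map x (u ++ v))) !map_cat /=.
rewrite -[x i :: _ ++ _]/((x i :: map x u) ++ _) nest_cat.
rewrite -cat_rcons nest_cat (nest_fam_rcons u hX (hx i)).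
rewrite (linZ (nest_lin _)) scalerA; set c := (X in X *: _).
(* The entries of [t] below [i] are those of [u], so the inversions at the head of [i :: t] give the
   same sign as moving [x i] past [u], and the two cancel. *)
suff -> : c = 1 by rewrite scale1r.
move: iu; rewrite sorted_pairwise // pairwise_cat => /and3P[/allrelP uv _].
rewrite /= => /andP[/allP iv _].
rewrite /c (perm_big _ tu) /= big_cat /= [X in _ * X * _]big_seq_cond.
rewrite [X in _ * X * _]big_pred0; last first.
  by move=> j; apply/negP => /andP[/iv]; case: ltngtP.
rewrite mulr1 mulrC [deg u * _]mulrC sg_degr.
suff -> : \prod_(j <- u | (j < i)%N) sg (d i * d j)
    = \prod_(j <- u) sg (d i * d j) :> K by rewrite -big_split /= big1 // => j _; rewrite sgK.
by rewrite big_seq_cond [RHS]big_seq; apply: eq_bigl => j; case ju : (j \in u) => //=;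
  rewrite uv // inE eqxx.
Qed.

(** Iterated Leibniz rule: the arguments in [w.1] act on [X] and pass [Y], which gives the first
    sign; the second one unshuffles the arguments. *)
Lemma nest_br p q X Y t : homog p X -> homog q Y -> incr t ->
  nest (br X Y) (map x t) = \sum_(w <- splits t)
    (sg (q * deg w.1) * pair_sign K d w.1 w.2) *:
      br (nest X (map x w.1)) (nest Y (map x w.2)).
Proof.
elim: t p q X Y => [|i t ih] p q X Y hX hY.
  by rewrite big_seq1 big_nil mulr0 /pair_sign big_nil mulr1 scale1r.
rewrite incr_cons => /andP[/allP it st].
have hXi : homog (p + d i) (br X (I (x i))) by apply: br_homog => //; apply: I_homog.
have hYi : homog (q + d i) (br Y (I (x i))) by apply: br_homog => //; apply: I_homog.
rewrite [LHS]/nest /= -/(nest _ (map x t)).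
rewrite (br_leibniz hX hY (I_homog (hx i))) addrC (nest_lin (map x t)).
rewrite (ih _ _ _ _ hX hYi st) (ih _ _ _ _ hXi hY st) big_cat !big_map /=.
have sub w : w \in splits t -> all (fun j : 'I_n => i < j)%N w.1
    /\ all (fun j : 'I_n => i < j)%N w.2.
  by move=> /mem_splits_subseq/andP[/mem_subseq w1 /mem_subseq w2]; split;
    apply/allP => j; [move/w1 | move/w2]; apply: it.
rewrite scaler_sumr; congr (_ + _); rewrite !big_seq; apply: eq_bigr => w /sub [w1 w2].
  by rewrite pair_sign_consl // scalerA big_cons mulrDr sgD mulrA.
by rewrite pair_sign_consr // mulrDl sgD mulrA.
Qed.

(** The differences [X - I (P X)] and [Y - I (P Y)] lie in the kernel of [P], hence so does their
    bracket; in its expansion the bracket of the two abelian parts is zero. *)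
Lemma derived_br p q X Y : homog p X -> homog q Y ->
  P (br X Y) = P (br X (I (P Y))) - sg (p * q) *: P (br Y (I (P X))).
Proof.
move=> hX hY; have hPX := I_homog (P_homog hX).
have PB Z : P (Z - I (P Z)) = 0 by rewrite (linB P_lin) IK subrr.
have := P_ker (PB X) (PB Y).
rewrite (linB (br_linl _)) !(linB (br_linr _)) I_abelian subr0 !(linB P_lin).
move=> /eqP; rewrite subr_eq0 subr_eq => /eqP ->.
by rewrite (br_anti hPX hY) -scaleNr (linZ P_lin) scaleNr addrC.
Qed.

Lemma derived_jacobi t : [pchar K] =i pred0 -> incr t ->
  \sum_(w <- splits t)
    pair_sign K d w.1 w.2 *: derived (derived (map x w.1) :: map x w.2) = 0.
Proof.
move=> charK st; set J := \sum_(w <- _) _.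
have ut : uniq t.
  by apply: (sorted_uniq _ _ st); [move=> ? ? ?; apply: ltn_trans | move=> ?; apply: ltnn].
(* Expanding the square of [D] produces the relation twice, once from each term of [derived_br];
   characteristic zero allows division by 2. *)
suff /eqP : J + J = 0.
  rewrite -mulr2n -scaler_nat scaler_eq0 => /orP[|/eqP//].
  by have /pcharf0P/(_ 2) -> := charK.
have := congr1 P (nest_br D_homog D_homog st).
rewrite D_square (lin0 (nest_lin _)) (lin0 P_lin) (lin_sum P_lin) => /esym JE.
(* The second copy of [J] is summed over the swapped splittings: it matches the terms whose inner
   operation takes the arguments in [v]. *)
rewrite -{}JE /J -{2}(perm_big _ (splits_swap t)) big_map -big_split /=.
rewrite !big_seq; apply: eq_bigr => -[u v] /= uv.
have uuv : uniq (u ++ v) by rewrite (perm_uniq (mem_splits_perm uv)).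
have hu := nest_fam_homog u D_homog; have hv := nest_fam_homog v D_homog.
rewrite (linZ P_lin) (derived_br hu hv).
have E s z : P (br (nest D s) (I z)) = derived (rcons s z).
  by rewrite /derived /nest map_rcons foldl_rcons.
rewrite !E /derived (nest_fam_rcons u D_homog (P_homog hv)).
rewrite (nest_fam_rcons v D_homog (P_homog hu)) !(linZ P_lin).
rewrite addrC scalerBr -scalerN !scalerA -scaleNr scalerA; congr (_ *: _ + _ *: _).
  have -> : pair_sign K d v u = pair_sign K d u v * sg (deg u * deg v).
    by rewrite -(pair_signC K d uuv) mulrA -[LHS]mul1r; congr (_ * _);
      rewrite /pair_sign -big_split /= big1 // => i _; rewrite -big_split /= big1 // => j _;
      rewrite sgK.
  rewrite mul1r mulrDr mulr1 sgD; have := sgK K (deg u).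
  by move=> uu; rewrite mulrACA mulrA uu mul1r.
rewrite !mulrDr !mulrDl !mulr1 !mul1r !sgD sg1 [deg v * deg u]mulrC.
have := sgK K (deg u); have := sgK K (deg v); have := sgK K (deg u * deg v).
move: (sg _) (sg _) (sg _) (pair_sign _ _ _ _) => a b c f aa bb cc.
by ring: aa bb cc.
Qed.

End Family.

Theorem derived_Linf : [pchar K] =i pred0 -> is_Linf1 derived.
Proof.
move=> charK; split.
- split; first by rewrite /derived /nest /= PD.
    by move=> s1 s2 a y z; rewrite /derived nest_multilin P_lin.
  move=> ds s hs; rewrite addrC; apply: P_homog; exact: nest_homog.
- move=> n d x s hx; rewrite /permuted.
  have -> : [seq x ((1%g : 'S_n) i) | i <- enum 'I_n] = map x (enum 'I_n).
    by apply: eq_map => i; rewrite perm1.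
  rewrite (map_comp x s) /derived koszul_sign_list.
  rewrite (nest_sort hx D_homog (ord_enum_incr n)) ?(linZ P_lin) //.
  apply: uniq_perm; [|exact: enum_uniq|].
    by rewrite (map_inj_uniq (@perm_inj _ s)) enum_uniq.
  by move=> i; rewrite mem_enum -[i](permKV s) (mem_map (@perm_inj _ s)) mem_enum.
- move=> n d x hx; pose F u v :=
    pair_sign K d u v *: derived (derived (map x u) :: map x v).
  have E i : (i <= n)%N -> \sum_(s : 'S_n | is_shuffle i s) koszul_sign K d s *:
      derived (derived (take i (permuted x s)) :: drop i (permuted x s)) =
      \sum_(w <- splits (enum 'I_n) | size w.1 == i) F w.1 w.2.
    move=> i_n; rewrite -(sum_shuffles F i_n); apply: eq_bigr => s.
    rewrite is_shuffleP => /andP[s1 s2].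
    rewrite /F koszul_sign_list -(list_sign_cat K d s1 s2) cat_take_drop.
    by rewrite /permuted (map_comp x s) -map_take -map_drop.
  rewrite (eq_big_nat _ _ (F2 := fun i =>
    \sum_(w <- splits (enum 'I_n) | size w.1 == i) F w.1 w.2)); last first.
    by move=> i /andP[_ i_n]; apply: E.
  have J := derived_jacobi hx charK (ord_enum_incr n).
  rewrite -[RHS]J; under eq_bigr do rewrite big_mkcond.
  rewrite exchange_big big_seq [RHS]big_seq; apply: eq_bigr => w ws.
  (* Splittings include an empty first part, whereas the relation starts at [i = 1]; the extra term
     vanishes because [P D = 0]. *)
  case: (posnP (size w.1)) => [w0|w_gt0].
    rewrite big_nat big1 => [|i /andP[i_gt0 _]]; last by rewrite w0; case: i i_gt0.
    rewrite (size0nil w0) [X in derived (X :: _)]/derived [X in P X]/nest /= PD.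
    have := multilin0 [::] (map x w.2) (nest_multilin D); rewrite /derived /= => ->.
    by rewrite (lin0 P_lin) scaler0.
  rewrite (bigD1_seq (size w.1)) ?iota_uniq //=; last first.
    rewrite mem_index_iota w_gt0 ltnS -[X in (_ <= X)%N](size_enum_ord n).
    by rewrite -(perm_size (mem_splits_perm ws)) size_cat leq_addr.
  rewrite eqxx big1 ?addr0 // => i /negPf; rewrite eq_sym => ->.
  by [].
Qed.

End DerivedLinf.

(** * The pre-Lie identity *)

(* A decision procedure for linear identities between vectors: both sides are
   reified as formal combinations of atoms and compared coefficientwise. *)
Inductive lexp (K : Type) :=
  | LVar of nat | LZero | LAdd of lexp K & lexp K | LOpp of lexp K
  | LScale of K & lexp K.
Arguments LVar {K}.
Arguments LZero {K}.

Section LinearReflection.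
Variables (K : fieldType) (V : lmodType K).

Fixpoint leval (env : seq V) (e : lexp K) : V :=
  match e with
  | LVar i => nth 0 env i
  | LZero => 0
  | LAdd a b => leval env a + leval env b
  | LOpp a => - leval env a
  | LScale c a => c *: leval env a
  end.

Fixpoint lcoef (e : lexp K) (i : nat) : K :=
  match e with
  | LVar j => if eqn j i then 1 else 0
  | LZero => 0
  | LAdd a b => lcoef a i + lcoef b i
  | LOpp a => - lcoef a i
  | LScale c a => c * lcoef a i
  end.

Lemma leval_coef env e :
  leval env e = \sum_(i < size env) lcoef e i *: nth 0 env i.
Proof.
have eqE j i : eqn j i = (j == i) by [].
elim: e => [j||a ha b hb|a ha|c a ha] /=.
- have [jn|nj] := ltnP j (size env).
    rewrite (bigD1 (Ordinal jn)) //= eqE eqxx scale1r big1 ?addr0 // => i.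
    rewrite -val_eqE /= eq_sym eqE => /negPf ->; exact: scale0r.
  rewrite nth_default // big1 // => i _; rewrite eqE.
  by case: eqP (ltn_ord i) => [<-|]; rewrite ?scale0r // ltnNge nj.
- by rewrite big1 // => i _; rewrite scale0r.
- by rewrite ha hb -big_split; apply: eq_bigr => i _; rewrite scalerDl.
- by rewrite ha -sumrN; apply: eq_bigr => i _; rewrite scaleNr.
- by rewrite ha scaler_sumr; apply: eq_bigr => i _; rewrite scalerA.
Qed.

Lemma leval_eq env e1 e2 :
  foldr (fun i Q => lcoef e1 i = lcoef e2 i /\ Q) True (iota 0 (size env)) ->
  leval env e1 = leval env e2.
Proof.
move=> H; rewrite !leval_coef; apply: eq_bigr => i _; congr (_ *: _).
have : (i : nat) \in iota 0 (size env) by rewrite mem_iota /= add0n ltn_ord.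
by elim: (iota _ _) H => //= j s ih [ji /ih h]; rewrite inE => /orP[/eqP->|].
Qed.

End LinearReflection.

(* Unification with respect to an empty hint database unfolds no constant, so
   that atoms are compared up to beta-eta only. *)
Create HintDb lmod.

Ltac lmod_mem t env :=
  lazymatch env with
  | cons ?y ?env => first [unify t y with lmod | lmod_mem t env]
  end.

Ltac lmod_atoms t env :=
  lazymatch t with
  | ?a + ?b => let env := lmod_atoms a env in lmod_atoms b env
  | - ?a => lmod_atoms a env
  | _ *: ?a => lmod_atoms a env
  | 0 => env
  | _ => match env with
         | _ => let _ := match env with _ => lmod_mem t env end in env
         | _ => constr:(cons t env)
         end
  end.

Ltac lmod_index t env :=
  lazymatch env with
  | cons ?y ?env =>
    match env with
    | _ => let _ := match env with _ => unify t y with lmod end in constr:(O)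
    | _ => let k := lmod_index t env in constr:(S k)
    end
  end.

Ltac lmod_reify K t env :=
  lazymatch t with
  | ?a + ?b =>
    let a := lmod_reify K a env in let b := lmod_reify K b env in
    constr:(@LAdd K a b)
  | - ?a => let a := lmod_reify K a env in constr:(@LOpp K a)
  | ?c *: ?a => let a := lmod_reify K a env in constr:(@LScale K c a)
  | 0 => constr:(@LZero K)
  | _ => let k := lmod_index t env in constr:(@LVar K k)
  end.

(** Leaves one scalar identity per atom, to be closed by [ring]. *)
Ltac lmod K :=
  lazymatch goal with |- @eq ?T ?a ?b =>
    let env := lmod_atoms a (@nil T) in
    let env := lmod_atoms b env in
    let a' := lmod_reify (GRing.Field.sort K) a env in
    let b' := lmod_reify (GRing.Field.sort K) b env in
    apply: (@leval_eq K _ env a' b');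
    cbn [foldr iota size lcoef eqn]; repeat split
  end.

(** * Sums over the cuts of a list into two consecutive parts *)

Section CutSum.
Variables (T : Type) (W : zmodType).
Implicit Types (psi : seq T -> seq T -> W) (s a b : seq T).

Definition cut_sum psi s : W :=
  \sum_(0 <= k < (size s).+1) psi (take k s) (drop k s).

Lemma cut_sum_nil psi : cut_sum psi [::] = psi [::] [::].
Proof. by rewrite /cut_sum big_nat1. Qed.

Lemma cut_sum_cons psi v s :
  cut_sum psi (v :: s) = psi [::] (v :: s) + cut_sum (fun a b => psi (v :: a) b) s.
Proof. by rewrite /cut_sum big_nat_recl. Qed.

Lemma eq_cut_sum psi psi' s :
  (forall a b, s = a ++ b -> psi a b = psi' a b) -> cut_sum psi s = cut_sum psi' s.
Proof. by move=> h; apply: eq_bigr => k _; apply: h; rewrite cat_take_drop. Qed.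

Lemma cut_sumD psi psi' s :
  cut_sum (fun a b => psi a b + psi' a b) s = cut_sum psi s + cut_sum psi' s.
Proof. exact: big_split. Qed.

(** Coassociativity of deconcatenation: both sides sum over the cuts into three consecutive
    parts. *)
Lemma cut_sumA (chi : seq T -> seq T -> seq T -> W) s :
  cut_sum (fun a b => cut_sum (chi a) b) s =
  cut_sum (fun a b => cut_sum (fun c e => chi c e b) a) s.
Proof.
elim: s chi => [|v s ih] chi; first by rewrite !cut_sum_nil.
rewrite !cut_sum_cons ih cut_sum_nil -addrA; congr (_ + _).
rewrite -cut_sumD; apply: eq_cut_sum => a b _.
by rewrite cut_sum_cons.
Qed.

End CutSum.

(** * Multilinear maps on lists and insertion of one map into another *)

Section Insertion.
Variables (K : fieldType) (V : gradedSpace K).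
Local Notation kos n := (map (koszul (n : int))).

Lemma gpr_decomp (W : gradedSpace K) (x : W) :
  exists r : seq int, x = \sum_(d <- r) gpr d x.
Proof.
have [r ur rx] := gpr_supp x; exists r.
rewrite {1}[x]gpr_sum (fsbigE r) //.
  by under eq_bigl do rewrite in_setT.
by move=> d _ dr; apply/eqP; apply: contraNT dr => /rx.
Qed.

Section Ext.
Variable W : gradedSpace K.
Implicit Types f g : seq V -> W.

Lemma multilin_sum f s1 s2 I (r : seq I) F : multilin f ->
  f (s1 ++ \sum_(i <- r) F i :: s2) = \sum_(i <- r) f (s1 ++ F i :: s2).
Proof.
move=> fl; apply: (lin_sum (f := fun z => f (s1 ++ z :: s2))) => a x y.
exact: fl.
Qed.

Lemma multilin_cons f v : multilin f -> multilin (fun s => f (v :: s)).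
Proof. by move=> fl s1 s2 a x y; apply: (fl (v :: s1)). Qed.

(** The entries are decomposed into homogeneous components one at a time; the induction carries a
    prefix [s] that is already homogeneous. *)
Lemma multilin_ext f g : multilin f -> multilin g ->
  (forall ds s, homogs ds s -> f s = g s) -> f =1 g.
Proof.
move=> fl gl fg t.
suff H ds s : homogs ds s -> f (s ++ t) = g (s ++ t) by apply: (H [::] [::]).
elim: t ds s => [|v t ih] ds s hs; first by rewrite !cats0 (fg ds).
have [r ->] := gpr_decomp v.
rewrite !multilin_sum //; apply: eq_bigr => d _.
rewrite -!cat_rcons (ih (rcons ds d)) // -!cats1; apply: homogs_cat => //.
by rewrite /homogs /= gpr_homog.
Qed.

Lemma multilin_kos f n : multilin f -> multilin (fun s => f (kos n s)).
Proof. by move=> fl s1 s2 a x y; rewrite !map_cat /= koszul_linear fl. Qed.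

Lemma multilin_comp (U : gradedSpace K) (h : W -> U) f :
  linear h -> multilin f -> multilin (fun s => h (f s)).
Proof. by move=> hl fl s1 s2 a x y; rewrite fl hl. Qed.

Lemma multilin_scale f (c : K) : multilin f -> multilin (fun s => c *: f s).
Proof. by move=> fl s1 s2 a x y; rewrite fl scalerDr !scalerA mulrC. Qed.

Lemma multilin_kos_homog n f ds s t : multilin f -> homogs ds s ->
  f (kos n s ++ t) = sg (n * \sum_(d <- ds) d) *: f (s ++ t).
Proof.
move=> fl; elim: s ds f fl => [|v s ih] [|d ds] // f fl.
  by rewrite big_nil mulr0 scale1r.
move=> /andP[hv hs]; rewrite /= (koszul_on n hv) big_cons mulrDr sgD -scalerA.
rewrite (linZ (f := fun z => f (z :: _))) => [|a x y]; last exact: (fl [::]).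
by congr (_ *: _); rewrite (ih _ (fun s => f (v :: s)) (multilin_cons v fl) hs).
Qed.

Lemma koszul_Hom m n f : is_Hom m f ->
  forall s, koszul n (f s) = sg (m * n) *: f (kos n s).
Proof.
move=> [_ fl fd]; apply: multilin_ext => [||ds s hs].
- by apply: multilin_comp fl; apply: koszul_linear.
- by apply: multilin_scale; apply: multilin_kos.
- rewrite (koszul_on n (fd _ _ hs)) -[kos n s]cats0 (multilin_kos_homog _ _ fl hs).
  by rewrite cats0 scalerA -sgD [m * n]mulrC -mulrDr addrC.
Qed.

End Ext.

Lemma koszulK m n (x : V) : koszul m (koszul n x) = koszul (m + n) x.
Proof.
have [r ->] := gpr_decomp x; rewrite (lin_sum (koszul_linear n)).
rewrite (lin_sum (koszul_linear m)) (lin_sum (koszul_linear (m + n))).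
apply: eq_bigr => d _; have hd := gpr_homog d x.
rewrite !(koszul_on _ hd) (linZ (koszul_linear m)) (koszul_on _ hd) scalerA.
by rewrite -!/(sg _) -sgD -mulrDl addrC.
Qed.

Section Insert.
Variable W : gradedSpace K.
Implicit Types (phi : seq V -> W) (g : seq V -> V) (n : int) (s : seq V).

(** This is [hcomp n phi g] with any target for [phi]: the target is also taken to be [A] or [M]
    below, and inductions on the list vary [phi]. *)
Definition insert n g phi s : W :=
  \sum_(1 <= l < (size s).+1) \sum_(0 <= i < (size s - l).+1)
    phi (kos n (take i s) ++ g (take l (drop i s)) :: drop (i + l) s).

Lemma insert_nil n g phi : insert n g phi [::] = 0.
Proof. by rewrite /insert big_nil. Qed.

(** Either [v] stays outside the inner map and collects its sign, or the inner map starts at [v]. *)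
Lemma insert_cons n g phi v s : insert n g phi (v :: s) =
  insert n g (fun u => phi (koszul n v :: u)) s
  + cut_sum (fun a b => phi (g (v :: a) :: b)) s.
Proof.
rewrite /insert /cut_sum [size (v :: s)]/= !big_add1 /= [RHS]addrC.
under eq_bigr do rewrite subSS big_nat_recl //=.
rewrite big_split /=; congr (_ + _).
rewrite big_nat_recr //= subnn [X in _ + X]big_geq // addr0 big_nat [RHS]big_nat.
apply: eq_bigr => l /andP[_ ls].
by rewrite subnS prednK ?subn_gt0.
Qed.

Lemma eq_insert n g g' phi phi' s : g =1 g' -> phi =1 phi' ->
  insert n g phi s = insert n g' phi' s.
Proof.
by move=> gg pp; apply: eq_bigr => l _; apply: eq_bigr => i _; rewrite gg pp.
Qed.

Lemma insertD n g phi phi' s :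
  insert n g (fun u => phi u + phi' u) s = insert n g phi s + insert n g phi' s.
Proof. by rewrite /insert -big_split; apply: eq_bigr => l _; apply: big_split. Qed.

Lemma insert_scale n g phi (c : K) s :
  insert n g (fun u => c *: phi u) s = c *: insert n g phi s.
Proof.
by rewrite /insert scaler_sumr; apply: eq_bigr => l _; rewrite scaler_sumr.
Qed.

(** Insertion acts as a coderivation: the inner value lands in the left part, or in the right part
    after passing the left one. *)
Lemma insert_cut n g (psi : seq V -> seq V -> W) s :
  insert n g (cut_sum psi) s =
  cut_sum (fun a b => insert n g (psi^~ b) a) s
  + cut_sum (fun a b => insert n g (psi (kos n a)) b) s.
Proof.
elim: s psi => [|v s ih] psi.
  by rewrite !cut_sum_nil !insert_nil addr0.
rewrite insert_cons !cut_sum_cons insert_nil add0r insert_cons.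
under [X in insert n g X s + _]eq_fun do rewrite cut_sum_cons.
rewrite insertD ih.
under [X in _ + X = _]eq_cut_sum => a b _ do rewrite cut_sum_cons.
rewrite cut_sumD cut_sumA.
under [X in _ = X + _]eq_cut_sum => a b _ do rewrite insert_cons.
rewrite cut_sumD /=.
by lmod K; ring.
Qed.

End Insert.

Lemma lin_insert (W U : gradedSpace K) (h : W -> U) n g (phi : seq V -> W) s :
  linear h -> h (insert n g phi s) = insert n g (fun u => h (phi u)) s.
Proof.
by move=> hl; rewrite (lin_sum hl); apply: eq_bigr => l _; rewrite (lin_sum hl).
Qed.

Lemma lin_cut_sum (W U : gradedSpace K) (h : W -> U)
    (psi : seq V -> seq V -> W) s :
  linear h -> h (cut_sum psi s) = cut_sum (fun a b => h (psi a b)) s.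
Proof. by move=> hl; rewrite /cut_sum (lin_sum hl). Qed.

Section PreLie.
Variable W : gradedSpace K.
Implicit Types (phi : seq V -> W) (f g : seq V -> V) (m n : int) (s : seq V).

(** The associator [(phi o f) o g - phi o (f o g)] of the insertion product. *)
Definition assoc m n f g phi s : W :=
  insert n g (insert m f phi) s - insert (m + n) (insert n g f) phi s.

(** Terms with [g] nested inside [f] cancel. What remains with an inner map starting at [v] has [f]
    there and [g] on a later block, or the reverse. *)
Lemma assoc_cons m n f g phi v s :
  is_Hom m f -> is_Hom n g -> multilin phi ->
  let X m n f g := cut_sum (fun a b =>
    insert n g (fun u => phi (f (kos n (v :: a)) :: u)) b) s in
  assoc m n f g phi (v :: s) =
    assoc m n f g (fun u => phi (koszul (m + n) v :: u)) s
    + X m n f g + sg (m * n) *: X n m g f.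
Proof.
move=> hf hg pl X; have [_ fl _] := hf.
have plin b : linear (fun z => phi (z :: b)) by move=> a x y; apply: (pl [::]).
have flin b : linear (fun z => f (z :: b)) by move=> a x y; apply: (fl [::]).
have -> : sg (m * n) *: X n m g f =
    cut_sum (fun a b => insert m f (fun u => phi (koszul m (g (v :: a)) :: u)) b) s.
  rewrite /X /cut_sum scaler_sumr; apply: eq_bigr => k _.
  rewrite -insert_scale; apply: eq_insert => // u.
  by rewrite (koszul_Hom m hg) [n * m]mulrC (linZ (plin u)).
rewrite /assoc !insert_cons.
under [X in insert n g X s + _]eq_fun do rewrite insert_cons.
rewrite insertD insert_cut.
under [X in _ + X - _]eq_cut_sum => a b _ do rewrite insert_cons.
rewrite cut_sumD cut_sumA.
have -> : cut_sum (fun a b => phi (insert n g f (v :: a) :: b)) s =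
  cut_sum (fun a b => insert n g (fun u => phi (f (koszul n v :: u) :: b)) a) s
  + cut_sum (fun a b => cut_sum (fun c e => phi (f (g (v :: c) :: e) :: b)) a) s.
  rewrite -cut_sumD; apply: eq_cut_sum => a b _.
  rewrite insert_cons (linD (plin b)) (lin_insert _ _ _ _ (plin b)).
  by rewrite (lin_cut_sum _ _ (plin b)).
under [X in insert n g (insert m f X) s]eq_fun do rewrite koszulK.
by rewrite /X; lmod K; ring.
Qed.

(** Exchanging [f] and [g] exchanges the two families of disjoint insertions in [assoc_cons]. *)
Lemma assoc_sym m n f g phi s : is_Hom m f -> is_Hom n g -> multilin phi ->
  assoc m n f g phi s = sg (m * n) *: assoc n m g f phi s.
Proof.
move=> hf hg; elim: s phi => [|v s ih] phi pl.
  by rewrite /assoc !insert_nil subrr scaler0.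
rewrite !assoc_cons //= ih; last exact: multilin_cons.
rewrite [n + m]addrC [n * m]mulrC; have := sgK K (m * n).
by move: (sg _) => e ee; lmod K; ring: ee.
Qed.

End PreLie.
End Insertion.

(** * The graded Lie algebra of multilinear maps *)

Section GradedLie.
Variables (K : fieldType) (V : gradedSpace K).
Implicit Types (f g h : seq V -> V) (m n p e : int) (s : seq V) (F G H : gHom V V).

Lemma insert_linl n g f f' a s :
  insert n g (a *: f + f') s = a *: insert n g f s + insert n g f' s.
Proof. by rewrite -insert_scale -insertD. Qed.

Lemma insert_linr n g g' f a s : multilin f ->
  insert n (a *: g + g') f s = a *: insert n g f s + insert n g' f s.
Proof.
move=> fl; rewrite /insert scaler_sumr -big_split; apply: eq_bigr => l _ /=.
by rewrite scaler_sumr -big_split; apply: eq_bigr => i _ /=; rewrite fl.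
Qed.

Lemma hbracketE m n f g :
  hbracket m n f g = (- sg (m * n)) *: insert m f g + insert n g f.
Proof. by rewrite scaleNr addrC. Qed.

Lemma hbracket_linl m n f f' g a : multilin g ->
  hbracket m n (a *: f + f') g = a *: hbracket m n f g + hbracket m n f' g.
Proof.
move=> gl; apply/funext => s; rewrite !hbracketE.
change ((- sg (m * n)) *: insert m (a *: f + f') g s + insert n g (a *: f + f') s =
  a *: ((- sg (m * n)) *: insert m f g s + insert n g f s)
  + ((- sg (m * n)) *: insert m f' g s + insert n g f' s)).
by rewrite insert_linl insert_linr //; lmod K; ring.
Qed.

Lemma hbracket_linr m n f g g' a : multilin f ->
  hbracket m n f (a *: g + g') = a *: hbracket m n f g + hbracket m n f g'.
Proof.
move=> fl; apply/funext => s; rewrite !hbracketE.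
change ((- sg (m * n)) *: insert m f (a *: g + g') s + insert n (a *: g + g') f s =
  a *: ((- sg (m * n)) *: insert m f g s + insert n g f s)
  + ((- sg (m * n)) *: insert m f g' s + insert n g' f s)).
by rewrite insert_linl insert_linr //; lmod K; ring.
Qed.

Lemma hbracket0l n m g : multilin g -> hbracket m n 0 g = 0.
Proof.
move=> gl; have := hbracket_linl m n 0 0 (-1) gl.
by rewrite scaler0 addr0 scaleN1r addNr.
Qed.

Lemma hbracket0r n m f : multilin f -> hbracket m n f 0 = 0.
Proof.
move=> fl; have := hbracket_linr m n 0 0 (-1) fl.
by rewrite scaler0 addr0 scaleN1r addNr.
Qed.

Lemma hbracket_anti m n f g :
  hbracket m n f g = - (sg (m * n) *: hbracket n m g f).
Proof.
apply/funext => s; rewrite !hbracketE.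
change ((- sg (m * n)) *: insert m f g s + insert n g f s =
  - (sg (m * n) *: ((- sg (n * m)) *: insert n g f s + insert m f g s))).
rewrite [n * m]mulrC; have := sgK K (m * n).
by move: (sg _) => c cc; lmod K; ring: cc.
Qed.

(** The commutator of a pre-Lie product satisfies the Jacobi identity: after expansion it is a
    combination of [assoc_sym] with outer map [f], [g] and [h] in turn. *)
Lemma hbracket_leibniz m n p f g h : is_Hom m f -> is_Hom n g -> is_Hom p h ->
  hbracket (m + n) p (hbracket m n f g) h =
  hbracket m (n + p) f (hbracket n p g h)
  + sg (n * p) *: hbracket (m + p) n (hbracket m p f h) g.
Proof.
move=> hf hg hh; have [_ fl _] := hf; have [_ gl _] := hg; have [_ hl _] := hh.
apply/funext => s; rewrite !hbracketE.
change (
  (- sg ((m + n) * p)) *: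
    insert (m + n) ((- sg (m * n)) *: insert m f g + insert n g f) h s
  + insert p h ((- sg (m * n)) *: insert m f g + insert n g f) s =
  (- sg (m * (n + p))) *:
    insert m f ((- sg (n * p)) *: insert n g h + insert p h g) s
  + insert (n + p) ((- sg (n * p)) *: insert n g h + insert p h g) f s
  + sg (n * p) *: ((- sg ((m + p) * n)) *:
      insert (m + p) ((- sg (m * p)) *: insert m f h + insert p h f) g s
    + insert n g ((- sg (m * p)) *: insert m f h + insert p h f) s)).
rewrite !insert_linl !insert_linr //.
have := assoc_sym s hg hh fl; have := assoc_sym s hf hh gl.
have := assoc_sym s hf hg hl; rewrite /assoc.
move=> /eqP; rewrite subr_eq => /eqP ->; move=> /eqP; rewrite subr_eq => /eqP ->.
move=> /eqP; rewrite subr_eq => /eqP ->.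
rewrite [n + m]addrC [p + m]addrC [p + n]addrC !mulrDl !mulrDr !sgD [p * n]mulrC.
have := sgK K (m * n); have := sgK K (m * p); have := sgK K (n * p).
move: (sg (n * p)) (sg (m * p)) (sg (m * n)) => a b c aa bb cc.
by lmod K; ring: aa bb cc.
Qed.

Lemma gHom_homogP (W : gradedSpace K) d (F : gHom V W) :
  homog d F <-> forall e, e != d -> F e = 0.
Proof.
split=> [/eqP FE e ed|F0]; first by rewrite -FE /= /single (negPf ed).
by apply/eqP/gHom_ext => e s; rewrite /= /single; case: eqP => [->//|/eqP ed]; rewrite (F0 e ed).
Qed.

Lemma gHom_multilin (W : gradedSpace K) (F : gHom V W) m : multilin (F m).
Proof. by case: (gHomP F) => /(_ m) []. Qed.

Lemma gHom_Hom (W : gradedSpace K) (F : gHom V W) m : is_Hom m (F m).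
Proof. by case: (gHomP F). Qed.

Lemma gHom_supp F : exists r : seq int, forall m, F m <> 0 -> m \in r.
Proof.
have [_ /finite_seqP [r rE]] := gHomP F; exists r => m Fm.
by have : [set n | F n <> 0]%classic m by []; rewrite rE.
Qed.

(** Any duplicate-free list containing the support of [F] may serve, so that sums for two maps can
    be compared over a common list. *)
Lemma bracket_funE (r : seq int) F G e s :
  uniq r -> (forall m, F m <> 0 -> m \in r) ->
  bracket F G e s = \sum_(m <- r) hbracket m (e - m) (F m) (G (e - m)) s.
Proof.
move=> ur rF; rewrite /= /bracket_fun (fsbigE r) //; last first.
  move=> m _ mr; rewrite (_ : F m = 0) ?hbracket0l //; first exact: gHom_multilin.
  by apply: contrapT => /rF; rewrite (negPf mr).
have [t tE] : exists t : seq int, t = [seq i <- r | i \in [set: int]%classic].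
  by eexists.
rewrite -big_filter -tE (_ : t = r); last first.
  by rewrite tE; apply/all_filterP/allP => i _; rewrite in_setT.
elim: r {ur rF tE t} => [|m r ih]; first by rewrite !big_nil.
by rewrite !big_cons -ih.
Qed.

Lemma bracket_linl G : linear (fun F => bracket F G).
Proof.
move=> a F F'; apply: gHom_ext => e s.
have [r rF] := gHom_supp F; have [r' rF'] := gHom_supp F'.
have ut := undup_uniq (r ++ r').
have tF m : F m <> 0 -> m \in undup (r ++ r').
  by move=> /rF; rewrite mem_undup mem_cat => ->.
have tF' m : F' m <> 0 -> m \in undup (r ++ r').
  by move=> /rF'; rewrite mem_undup mem_cat orbC => ->.
change (bracket (a *: F + F') G e s = a *: bracket F G e s + bracket F' G e s).
rewrite !(@bracket_funE (undup (r ++ r'))) //; last first.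
  move=> m Fm; apply/negPn/negP => mr; apply: Fm.
  change (a *: F m + F' m = 0).
  have -> : F m = 0 by apply: contrapT => /tF; rewrite (negPf mr).
  have -> : F' m = 0 by apply: contrapT => /tF'; rewrite (negPf mr).
  by rewrite scaler0 addr0.
rewrite scaler_sumr -big_split; apply: eq_bigr => m _.
change (hbracket m (e - m) (a *: F m + F' m) (G (e - m)) s =
  (a *: hbracket m (e - m) (F m) (G (e - m)) + hbracket m (e - m) (F' m) (G (e - m))) s).
by rewrite hbracket_linl //; apply: gHom_multilin.
Qed.

Lemma bracket_linr F : linear (bracket F).
Proof.
move=> a G G'; apply: gHom_ext => e s.
have [r rF] := gHom_supp F; have ut := undup_uniq r.
have tF m : F m <> 0 -> m \in undup r by move=> /rF; rewrite mem_undup.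
change (bracket F (a *: G + G') e s = a *: bracket F G e s + bracket F G' e s).
rewrite !(@bracket_funE (undup r)) //.
rewrite scaler_sumr -big_split; apply: eq_bigr => m _.
change (hbracket m (e - m) (F m) (a *: G (e - m) + G' (e - m)) s =
  (a *: hbracket m (e - m) (F m) (G (e - m)) + hbracket m (e - m) (F m) (G' (e - m))) s).
by rewrite hbracket_linr //; apply: gHom_multilin.
Qed.

Lemma bracketE m n F G e s : homog m F -> homog n G ->
  bracket F G e s = if e == m + n then hbracket m n (F m) (G n) s else 0.
Proof.
move=> /gHom_homogP hF /gHom_homogP hG; rewrite (@bracket_funE [:: m]) //; last first.
  by move=> k Fk; rewrite inE; apply/negPn/negP => /hF.
rewrite big_seq1; case: eqP => [->|/eqP emn]; first by rewrite addrC addKr.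
rewrite hG ?hbracket0r //; first exact: gHom_multilin.
by apply: contra_neq emn => <-; rewrite addrC subrK.
Qed.

Lemma bracket_homog m n F G : homog m F -> homog n G -> homog (m + n) (bracket F G).
Proof.
move=> hF hG; apply/gHom_homogP => e emn; apply/funext => s.
by rewrite (bracketE _ _ hF hG) (negPf emn).
Qed.

Lemma bracket_anti m n F G : homog m F -> homog n G ->
  bracket F G = - (sg (m * n) *: bracket G F).
Proof.
move=> hF hG; apply: gHom_ext => e s.
change (bracket F G e s = - (sg (m * n) *: bracket G F e s)).
rewrite (bracketE _ _ hF hG) (bracketE _ _ hG hF) [n + m]addrC.
by case: ifP => _; rewrite ?scaler0 ?oppr0 // hbracket_anti.
Qed.

Lemma bracket_leibniz m n p F G H : homog m F -> homog n G -> homog p H ->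
  bracket (bracket F G) H =
  bracket F (bracket G H) + sg (n * p) *: bracket (bracket F H) G.
Proof.
move=> hF hG hH; apply: gHom_ext => e s.
change (bracket (bracket F G) H e s =
  bracket F (bracket G H) e s + sg (n * p) *: bracket (bracket F H) G e s).
have E k l (A B : gHom V V) : homog k A -> homog l B ->
    bracket A B (k + l) = hbracket k l (A k) (B l).
  by move=> hA hB; apply/funext => t; rewrite (bracketE _ _ hA hB) eqxx.
rewrite (bracketE _ _ (bracket_homog hF hG) hH).
rewrite (bracketE _ _ hF (bracket_homog hG hH)).
rewrite (bracketE _ _ (bracket_homog hF hH) hG).
rewrite !E // [m + p + n]addrAC addrA.
case: ifP => _; last by rewrite scaler0 addr0.
by rewrite hbracket_leibniz //; apply: gHom_Hom.
Qed.

End GradedLie.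

(** * The square of the total structure map *)

Section Morphisms.
Variable K : fieldType.

Lemma koszul_morph (V W : gradedSpace K) (h : V -> W) n x : linear h ->
  (forall d y, homog d y -> homog d (h y)) -> koszul n (h x) = h (koszul n x).
Proof.
move=> hl hd; have [r ->] := gpr_decomp x.
rewrite (lin_sum hl) (lin_sum (koszul_linear n)) (lin_sum (koszul_linear n)) (lin_sum hl).
apply: eq_bigr => d _; have yd := gpr_homog d x.
by rewrite (koszul_on _ yd) (koszul_on _ (hd _ _ yd)) (linZ hl).
Qed.

Lemma cut_sum_map (T U : Type) (W : zmodType) (f : T -> U)
    (psi : seq U -> seq U -> W) s :
  cut_sum psi (map f s) = cut_sum (fun a b => psi (map f a) (map f b)) s.
Proof.
by rewrite /cut_sum size_map; apply: eq_bigr => k _; rewrite map_take map_drop.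
Qed.

(** Naturality of insertion, used for the projection of [A (+) M] onto [A], which carries
    [triangle_fun] to [mu]. *)
Lemma insert_morph (V U W : gradedSpace K) (h : V -> U) n f g (phi : seq U -> W) s :
  (forall x, koszul n (h x) = h (koszul n x)) ->
  (forall t, h (f t) = g (map h t)) ->
  insert n f (fun u => phi (map h u)) s = insert n g phi (map h s).
Proof.
move=> hk hfg; rewrite /insert size_map; apply: eq_bigr => l _; apply: eq_bigr => i _.
rewrite map_cat /= hfg -!map_drop -!map_take -!map_comp; congr (phi (_ ++ _)).
by apply: eq_map => x; rewrite /= hk.
Qed.

(** On homogeneous entries the sign operators become the explicit signs in which the relations of
    [A] and [M] are stated. *)
Lemma insert_homogs (V W : gradedSpace K) n g (phi : seq V -> W) ds s :
  multilin phi -> homogs ds s -> insert n g phi s =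
  \sum_(1 <= l < (size s).+1) \sum_(0 <= i < (size s - l).+1)
    sg (n * \sum_(d <- take i ds) d) *:
      phi (take i s ++ g (take l (drop i s)) :: drop (i + l) s).
Proof.
move=> pl hs; apply: eq_bigr => l _; apply: eq_bigr => i _.
exact: multilin_kos_homog pl (homogs_take i hs).
Qed.

End Morphisms.

(** * Sums over the slot of the bimodule argument *)

Section SlotSum.
Variables (K : fieldType) (A M : gradedSpace K) (W : zmodType).
Implicit Types (psi : seq A -> M -> seq A -> W) (s : seq (A * M)%type).

(** The extension by zero to [A (+) M] of a map on tensors with exactly one factor in [M], as in the
    second component of [triangle_fun]. *)
Definition slot_sum psi s : W := \sum_(0 <= p < size s)
  psi (map fst (take p s)) (nth 0 s p).2 (map fst (drop p.+1 s)).

Lemma slot_sum_nil psi : slot_sum psi [::] = 0.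
Proof. by rewrite /slot_sum big_nil. Qed.

Lemma slot_sum_cons psi x s : slot_sum psi (x :: s) =
  psi [::] x.2 (map fst s) + slot_sum (fun l => psi (x.1 :: l)) s.
Proof. by rewrite /slot_sum big_nat_recl //= drop0. Qed.

Lemma slot_sumD psi psi' s :
  slot_sum (fun l m r => psi l m r + psi' l m r) s = slot_sum psi s + slot_sum psi' s.
Proof. exact: big_split. Qed.

Lemma eq_slot_sum psi psi' s : (forall l m r, psi l m r = psi' l m r) ->
  slot_sum psi s = slot_sum psi' s.
Proof. by move=> h; apply: eq_bigr => p _; apply: h. Qed.

(** With the slot in the left part, the cut divides the arguments after the slot; the next lemma is
    the mirror image. *)
Lemma cut_slot_l (chi : seq A -> M -> seq A -> seq A -> W) s :
  cut_sum (fun a b => slot_sum (fun l m r => chi l m r (map fst b)) a) s =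
  slot_sum (fun l m r => cut_sum (chi l m) r) s.
Proof.
elim: s chi => [|x s ih] chi; first by rewrite cut_sum_nil !slot_sum_nil.
rewrite cut_sum_cons !slot_sum_nil add0r slot_sum_cons -ih cut_sum_map -cut_sumD.
by apply: eq_cut_sum => a b _; rewrite slot_sum_cons.
Qed.

Lemma cut_slot_r (chi : seq A -> seq A -> M -> seq A -> W) s :
  cut_sum (fun a b => slot_sum (chi (map fst a)) b) s =
  slot_sum (fun l m r => cut_sum (fun a b => chi a b m r) l) s.
Proof.
elim: s chi => [|x s ih] chi; first by rewrite cut_sum_nil !slot_sum_nil.
rewrite cut_sum_cons !slot_sum_cons /= -addrA cut_sum_nil; congr (_ + _).
rewrite (ih (fun a => chi (x.1 :: a))) -slot_sumD.
by apply: eq_slot_sum => l m r; rewrite cut_sum_cons.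
Qed.

End SlotSum.

(** * The total structure map composed with itself *)

Section TriangleSquare.
Variables (K : fieldType) (A M : gradedSpace K).
Variables (mu : seq A -> A) (eta : seq A -> M -> seq A -> M).
Hypotheses (Amu : is_Ainf1 mu) (Meta : is_bimodule mu eta).

Local Notation V := (A * M)%type.
Local Notation kos := (map (koszul 1)).
Local Notation tri := (triangle_fun mu eta).

Lemma koszul_fst n (x : V) : koszul n x.1 = (koszul n x).1.
Proof.
by apply: (koszul_morph (h := fst)) => // d y /eqP /(congr1 fst) e; apply/eqP.
Qed.

Lemma koszul_snd n (x : V) : koszul n x.2 = (koszul n x).2.
Proof.
by apply: (koszul_morph (h := snd)) => // d y /eqP /(congr1 snd) e; apply/eqP.
Qed.

Lemma insert_tri_fst (W : gradedSpace K) (phi : seq A -> W) (s : seq V) :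
  insert 1 tri (fun u => phi (map fst u)) s = insert 1 mu phi (map fst s).
Proof. by apply: insert_morph => // x; apply: koszul_fst. Qed.

(** The left side of the bimodule relation with the outer [eta] replaced by [psi], which varies in
    the induction below, and with signs carried by [koszul]. *)
Definition bimod_defect (psi : seq A -> M -> seq A -> M) l m r : M :=
  insert 1 mu (fun l' => psi l' m r) l
  + cut_sum (fun a b => cut_sum (fun c e => psi (kos a) (eta b m c) e) r) l
  + insert 1 mu (psi (kos l) (koszul 1 m)) r.

(** The outer slot holds an old argument, with [mu] inserted before or after it, or the inserted
    value, whose component in [M] is a sum over slots of the inner block. *)
Lemma insert_slot_sum (psi : seq A -> M -> seq A -> M) (s : seq V) :
  (forall l r, linear (fun m => psi l m r)) ->
  insert 1 tri (slot_sum psi) s = slot_sum (bimod_defect psi) s.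
Proof.
elim: s psi => [|x s ih] psi pl; first by rewrite insert_nil slot_sum_nil.
have pl' : forall l r, linear (fun m => psi (koszul 1 x.1 :: l) m r).
  by move=> l r; apply: pl.
rewrite insert_cons slot_sum_cons /bimod_defect insert_nil cut_sum_nil add0r.
under [X in insert 1 tri X s]eq_fun do rewrite slot_sum_cons -koszul_fst -koszul_snd.
rewrite insertD (ih _ pl').
rewrite insert_tri_fst.
(* Insertions starting at [x]: the inner slot is [x] itself, or lies later in the block, or the
   block is fed to [mu] and the slot comes after it. *)
have -> : cut_sum (fun a b => slot_sum psi (tri (x :: a) :: b)) s =
  cut_sum (fun c e => psi [::] (eta [::] x.2 c) e) (map fst s)
  + slot_sum (fun l m r => cut_sum (fun c e => psi [::] (eta (x.1 :: l) m c) e) r) s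
  + slot_sum (fun l m r => cut_sum (fun a b => psi (mu (x.1 :: a) :: b) m r) l) s.
  rewrite -cut_slot_l -(cut_slot_r (fun a b => psi (mu (x.1 :: a) :: b))).
  rewrite cut_sum_map -!cut_sumD; apply: eq_cut_sum => a b _.
  have triE u : tri u = (mu (map fst u), slot_sum eta u) by [].
  rewrite slot_sum_cons triE /= slot_sum_cons.
  rewrite (linD (pl _ _)); congr (_ + _ + _).
  exact: (lin_sum (pl _ _)).
have -> : slot_sum (fun l => [eta bimod_defect psi (x.1 :: l)]) s =
  slot_sum (bimod_defect (fun l => psi (koszul 1 x.1 :: l))) s
  + slot_sum (fun l m r => cut_sum (fun a b => psi (mu (x.1 :: a) :: b) m r) l) s
  + slot_sum (fun l m r => cut_sum (fun c e => psi [::] (eta (x.1 :: l) m c) e) r) s.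
  rewrite -!slot_sumD; apply: eq_slot_sum => l m r.
  by rewrite /bimod_defect insert_cons cut_sum_cons /=; lmod K; ring.
by lmod K; ring.
Qed.

Lemma bimod_defect0 dl l d m dr r :
  homogs dl l -> homog d m -> homogs dr r -> bimod_defect eta l m r = 0.
Proof.
move=> hl hm hr; rewrite -[RHS](bimod_rel Meta hl hm hr) /bimod_defect.
have [ll lm lr] := And3 (bimod_linl Meta) (bimod_linm Meta) (bimod_linr Meta).
congr (_ + _ + _).
- rewrite (insert_homogs _ _ (ll m r) hl).
  by apply: eq_bigr => i _; apply: eq_bigr => p _; rewrite mul1r.
- apply: eq_bigr => p _; apply: eq_bigr => q _.
  rewrite -[kos _]cats0 (multilin_kos_homog 1 _ (ll _ _) (homogs_take p hl)).
  by rewrite cats0 mul1r.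
- rewrite (insert_homogs _ _ (lr _ _) hr).
  apply: eq_bigr => i _; apply: eq_bigr => p _.
  rewrite (koszul_on _ hm) (linZ (lm _ _)).
  rewrite -[kos _]cats0 (multilin_kos_homog 1 _ (ll _ _) hl) cats0 !scalerA.
  by congr (_ *: _); rewrite -!/(sg _) -!sgD; congr sg; ring.
Qed.

(** On homogeneous entries the first component is the relation of [A], and the second is a sum over
    slots of bimodule relations. *)
Lemma triangle_square (s : seq V) : insert 1 tri tri s = 0.
Proof.
have [mh mrel] := Amu; have [_ ml _] := mh.
have ht := triangle_is_Hom Amu Meta.
have [_ hl _] := hcomp_is_Hom ht ht.
move: s; apply: (multilin_ext hl) => [|ds s hs].
  by move=> s1 s2 a x y; rewrite scaler0 addr0.
move: hs; rewrite homogs_pair => /andP[hs1 hs2].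
have pairE (z : V) : z.1 = 0 -> z.2 = 0 -> z = 0 by case: z => /= ? ? -> ->.
change (insert 1 tri tri s = 0); apply: pairE.
  rewrite (lin_insert (h := fst)) //.
  rewrite insert_tri_fst.
  rewrite (insert_homogs _ _ ml hs1) -[RHS](mrel _ _ hs1).
  by apply: eq_bigr => i _; apply: eq_bigr => p _; rewrite mul1r.
rewrite (lin_insert (h := snd)) //.
rewrite [LHS](insert_slot_sum s (bimod_linm Meta)) /slot_sum big_nat big1 // => p.
move=> /andP[_ ps].
apply: (@bimod_defect0 (take p ds) _ (nth 0 ds p) _ (drop p.+1 ds)).
- by rewrite map_take; apply: homogs_take.
- by have := @homogs_nth _ _ p _ _ hs2; rewrite size_map (nth_map 0) // => ->.
- by rewrite map_drop; apply: homogs_drop.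
Qed.

Lemma triangle_homog : homog 1 (triangle Amu Meta).
Proof. by apply/gHom_homogP => e /negPf e1; rewrite /= /single e1. Qed.

Lemma bracket_triangle : bracket (triangle Amu Meta) (triangle Amu Meta) = 0.
Proof.
apply: gHom_ext => e s; rewrite (bracketE _ _ triangle_homog triangle_homog).
case: ifP => // _; rewrite hbracketE /= /single eqxx.
change ((- sg (1 * 1)) *: insert 1 tri tri s + insert 1 tri tri s = 0).
by rewrite triangle_square scaler0 addr0.
Qed.

End TriangleSquare.

(** * Projection and arity filtration *)

Section Voronov.
Variables (K : fieldType) (A M : gradedSpace K).
Local Notation V := (A * M)%type.
Local Notation frak_a := (gHom M A).
Local Notation inM := (fun m : M => (0, m) : V).
Implicit Types (theta : frak_a) (F G : gHom V V).

Lemma incl_linear : linear (@Defs.incl K A M).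
Proof.
move=> a t t'; apply: gHom_ext => e s.
change (((a *: t e (map snd s) + t' e (map snd s), 0) : V) =
  a *: (t e (map snd s), 0) + (t' e (map snd s), 0)).
by congr pair; rewrite /= scaler0 addr0.
Qed.

Lemma proj_linear : linear (@Defs.proj K A M).
Proof. by move=> a F G; apply: gHom_ext => e s. Qed.

Lemma incl_homog d theta : homog d theta -> homog d (Defs.incl theta).
Proof.
move=> /gHom_homogP h; apply/gHom_homogP => e ed.
by apply/funext => s; rewrite /= /incl_fun h.
Qed.

Lemma proj_homog d F : homog d F -> homog d (proj F).
Proof.
move=> /gHom_homogP h; apply/gHom_homogP => e ed.
by apply/funext => s; rewrite /= /proj_fun h.
Qed.

(** The inner value has zero component in [M], the only component that the outer map reads. *)
Lemma insert_incl n m k theta theta' (s : seq V) :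
  insert n (Defs.incl theta m) (Defs.incl theta' k) s = 0.
Proof.
rewrite /insert big1 // => l _; rewrite big1 // => i _.
rewrite /= /incl_fun map_cat /= multilin0 //; exact: gHom_multilin.
Qed.

Lemma bracket_incl theta theta' : bracket (Defs.incl theta) (Defs.incl theta') = 0.
Proof.
apply: gHom_ext => e s; have [r rF] := gHom_supp (Defs.incl theta).
rewrite (@bracket_funE _ _ (undup r)) ?undup_uniq //; last first.
  by move=> m /rF; rewrite mem_undup.
rewrite big1 // => m _; rewrite hbracketE.
change ((- sg (m * (e - m))) *: insert m (Defs.incl theta m) (Defs.incl theta' (e - m)) s
  + insert (e - m) (Defs.incl theta' (e - m)) (Defs.incl theta m) s = 0).
by rewrite !insert_incl scaler0 addr0.
Qed.

(** On arguments from [M] the inner value lies in [M] again, so the outer map also sees only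
    arguments from [M]. *)
Lemma insert_proj0 n m k F G (s : seq M) : proj F = 0 -> proj G = 0 ->
  (insert n (F m) (G k) (map inM s)).1 = 0.
Proof.
have P0 H : proj H = 0 -> forall e t, (H e (map inM t)).1 = 0.
  by move=> H0 e t; have := congr1 (fun Z : frak_a => Z e t) H0.
move=> /P0 F0 /P0 G0; rewrite (lin_insert (h := fst)) // /insert.
rewrite big1 // => l _; rewrite big1 // => i _.
rewrite -!map_drop -!map_take -map_comp.
have -> : F m (map inM (take l (drop i s))) =
    inM (F m (map inM (take l (drop i s)))).2 by rewrite [LHS]surjective_pairing F0.
have kE : koszul n \o inM =1 inM \o koszul n.
  move=> x; rewrite /= [LHS]surjective_pairing -koszul_fst -koszul_snd.
  by rewrite (lin0 (koszul_linear n)).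
by rewrite (eq_map kE) map_comp -map_cons -map_cat.
Qed.

Lemma proj_bracket F G : proj F = 0 -> proj G = 0 -> proj (bracket F G) = 0.
Proof.
move=> F0 G0; apply: gHom_ext => e s; have [r rF] := gHom_supp F.
change ((bracket F G e (map inM s)).1 = 0).
rewrite (@bracket_funE _ _ (undup r)) ?undup_uniq //; last first.
  by move=> m /rF; rewrite mem_undup.
rewrite (lin_sum (f := fst)) // big1 // => m _; rewrite hbracketE.
change ((- sg (m * (e - m))) *: (insert m (F m) (G (e - m)) (map inM s)).1
  + (insert (e - m) (G (e - m)) (F m) (map inM s)).1 = 0).
by rewrite !insert_proj0 // scaler0 addr0.
Qed.

Lemma multilin_zeros (U W : gradedSpace K) (f : seq U -> W) (s : seq U) :
  f [::] = 0 -> multilin f -> {in s, forall x, x = 0} -> f s = 0.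
Proof.
move=> f0 fl; case: s => // x s /(_ x); rewrite inE eqxx => /(_ isT) ->.
exact: (multilin0 [::]).
Qed.

(** * Weight estimate for iterated brackets *)

Section Excess.

(** Lists over the disjoint union record which factors lie in [A] and which in [M], so that weights
    can be counted. *)
Definition emb (x : A + M) : V :=
  match x with inl a => (a, 0) | inr m => (0, m) end.

Definition nM (t : seq (A + M)) : nat :=
  count (fun x => if x is inr _ then true else false) t.

(* Counting a factor or a value in M with weight 1 and in A with weight 0, the
   weight of the arguments exceeds that of a nonzero value by at least k. *)
Definition excess (k : nat) (f : seq V -> V) : Prop := forall t,
  ((nM t < k)%N -> (f (map emb t)).1 = 0) /\ ((nM t <= k)%N -> (f (map emb t)).2 = 0).

Lemma excess_lin k a f g : excess k f -> excess k g -> excess k (a *: f + g).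
Proof.
move=> hf hg t; have [f1 f2] := hf t; have [g1 g2] := hg t.
split=> h.
  change (a *: (f (map emb t)).1 + (g (map emb t)).1 = 0).
  by rewrite f1 ?g1 // scaler0 addr0.
change (a *: (f (map emb t)).2 + (g (map emb t)).2 = 0).
by rewrite f2 ?g2 // scaler0 addr0.
Qed.

Lemma excess_sum k I (r : seq I) (f : I -> seq V -> V) :
  (forall i, excess k (f i)) -> excess k (fun s => \sum_(i <- r) f i s).
Proof.
move=> hf t; split=> h.
  by rewrite (lin_sum (f := fst)) // big1 // => i _; apply: (proj1 (hf i t) h).
by rewrite (lin_sum (f := snd)) // big1 // => i _; apply: (proj2 (hf i t) h).
Qed.

Lemma excess_insert n k k' f g : multilin f -> excess k f -> excess k' g ->
  excess (k + k') (insert n g f).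
Proof.
move=> fl hf hg t.
have kE t1 : exists2 t2, map (koszul n) (map emb t1) = map emb t2 & nM t2 = nM t1.
  exists (map (fun x => match x with inl a => inl (koszul n a)
                                   | inr m => inr (koszul n m) end) t1).
    have k0 (U : gradedSpace K) : koszul n (0 : U) = 0 by exact: lin0 (koszul_linear n).
    rewrite -!map_comp; apply: eq_map => -[] x;
      by rewrite /= [LHS]surjective_pairing -koszul_fst -koszul_snd /= k0.
  by rewrite /nM count_map; apply: eq_count => -[].
have D1 (y z : V) : y.1 = 0 -> z.1 = 0 -> (y + z).1 = 0.
  by move=> y0 z0; change (y.1 + z.1 = 0); rewrite y0 z0 addr0.
have D2 (y z : V) : y.2 = 0 -> z.2 = 0 -> (y + z).2 = 0.
  by move=> y0 z0; change (y.2 + z.2 = 0); rewrite y0 z0 addr0.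
have term i l : let z := f (map (koszul n) (take i (map emb t)) ++
      g (take l (drop i (map emb t))) :: drop (i + l) (map emb t)) in
    ((nM t < k + k')%N -> z.1 = 0) /\ ((nM t <= k + k')%N -> z.2 = 0).
  rewrite -!map_drop -!map_take; have [t1 -> t1E] := kE (take i t).
  set u := take l _; set t2 := drop (i + l) t.
  have tE : nM t = (nM t1 + nM u + nM t2)%N.
    rewrite t1E /nM -!count_cat -[X in count _ X = _](cat_take_drop i) -catA /u /t2.
    by rewrite addnC -drop_drop !cat_take_drop.
  have [u1 u2] := hg u; set y := g (map emb u) in u1 u2 *.
  (* The inner value splits into a part in [A] of weight 0 and a part in [M] of weight 1; the
     coefficient 1 gives the shape used by [multilin]. *)
  have -> : y = 1 *: emb (inl y.1) + emb (inr y.2).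
    rewrite scale1r /= [LHS]surjective_pairing.
    by congr pair; rewrite /= ?addr0 ?add0r.
  rewrite fl scale1r -!map_cons -!map_cat.
  have cE x : nM (t1 ++ x :: t2) =
      (nM t1 + (if x is inr _ then true else false) + nM t2)%N.
    by rewrite /nM count_cat /= addnA; case: x.
  have [fA1 fA2] := hf (t1 ++ inl y.1 :: t2).
  have [fM1 fM2] := hf (t1 ++ inr y.2 :: t2).
  have f0 x : x = 0 -> f (map emb t1 ++ x :: map emb t2) = 0.
    by move=> ->; apply: multilin0.
  rewrite !cE /= addn0 addn1 in fA1 fA2 fM1 fM2.
  rewrite !map_cat !map_cons in fA1 fA2 fM1 fM2 *.
  rewrite tE; split=> h.
    apply: D1.
      (* Either the inner block is too light and this part of its value is zero, or the outer list
         is too light for [f]. *)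
      have [ku|uk] := ltnP (nM u) k'; first by rewrite (f0 (emb (inl y.1))) //= u1.
      by apply: fA1; lia.
    have [ku|uk] := leqP (nM u) k'; first by rewrite (f0 (emb (inr y.2))) //= u2.
    by apply: fM1; lia.
  apply: D2.
    have [ku|uk] := ltnP (nM u) k'; first by rewrite (f0 (emb (inl y.1))) //= u1.
    by apply: fA2; lia.
  have [ku|uk] := leqP (nM u) k'; first by rewrite (f0 (emb (inr y.2))) //= u2.
  by apply: fM2; lia.
split=> h; rewrite /insert.
  rewrite (lin_sum (f := fst)) // big1 // => l _.
  by rewrite (lin_sum (f := fst)) // big1 // => i _; apply: (proj1 (term i l)).
rewrite (lin_sum (f := snd)) // big1 // => l _.
by rewrite (lin_sum (f := snd)) // big1 // => i _; apply: (proj2 (term i l)).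
Qed.

Lemma excess_bracket k k' F G :
  (forall e, excess k (F e)) -> (forall e, excess k' (G e)) ->
  forall e, excess (k + k') (bracket F G e).
Proof.
move=> hF hG e; have [r rF] := gHom_supp F.
have -> : bracket F G e = fun s => \sum_(m <- undup r)
    hbracket m (e - m) (F m) (G (e - m)) s.
  apply/funext => s; apply: bracket_funE; first exact: undup_uniq.
  by move=> m /rF; rewrite mem_undup.
apply: excess_sum => m; rewrite hbracketE; apply: excess_lin.
  by rewrite addnC; apply: excess_insert => //; apply: gHom_multilin.
by apply: excess_insert => //; apply: gHom_multilin.
Qed.

Lemma nM0_inl t : nM t = 0%N -> {in map emb t, forall z, z.2 = 0}.
Proof.
elim: t => // -[a|m] t ih //= t0 z; rewrite inE => /orP[/eqP->//|].
by apply: ih.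
Qed.

(** Without arguments in [M], every entry read by [theta] is zero; the empty list is covered by the
    convention [f [::] = 0]. *)
Lemma excess_incl theta e : excess 1 (Defs.incl theta e).
Proof.
move=> t; split=> //=; rewrite ltnS leqn0 => /eqP t0.
have [h0 hl _] := gHom_Hom theta e.
apply: multilin_zeros => // _ /mapP[z zt ->]; exact: (nM0_inl t0).
Qed.

Variables (mu : seq A -> A) (eta : seq A -> M -> seq A -> M).
Hypotheses (Amu : is_Ainf1 mu) (Meta : is_bimodule mu eta).

Lemma excess_triangle e : excess 0 (triangle Amu Meta e).
Proof.
move=> t; split=> //; rewrite leqn0 => /eqP t0.
rewrite /= /single; case: eqP => // _.
rewrite /= big_nat big1 // => p /andP[_ pt].
rewrite (nM0_inl t0); last exact: mem_nth.
exact: (lin0 (bimod_linm Meta _ _)).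
Qed.

(** Each bracket with an element of the abelian subalgebra raises the excess by 1, and the weight of
    a list from [M] is its length. *)
Lemma derived_bracket_arity (s : seq frak_a) :
  arity_filtration (size s) (derived_bracket Amu Meta s).
Proof.
have H : forall e, excess (size s)
    (foldl (@bracket K V) (triangle Amu Meta) (map (@Defs.incl K A M) s) e).
  elim/last_ind: s => [|s theta ih]; first exact: excess_triangle.
  rewrite map_rcons foldl_rcons size_rcons -addn1.
  by apply: excess_bracket => //; apply: excess_incl.
move=> e t ts; have := proj1 (H e (map inr t)).
by rewrite -map_comp /nM count_map (eq_count (a2 := xpredT)) // count_predT; apply.
Qed.

Lemma proj_triangle : proj (triangle Amu Meta) = 0.
Proof.
apply: gHom_ext => e s; rewrite /= /proj_fun /= /single; case: eqP => // _ /=.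
have [[m0 ml _] _] := Amu.
by apply: multilin_zeros => // _ /mapP[_ /mapP[m _ ->] ->].
Qed.

End Excess.

(** * Completeness of the arity filtration *)

Local Notation Fil := (@arity_filtration K A M).

Lemma arity_filtration_lin n : Fil n 0 /\
  forall a x y, Fil n x -> Fil n y ->
    Fil n (a *: x + y).
Proof.
split=> // a x y hx hy e s sn.
change (a *: x e s + y e s = 0).
by rewrite hx // hy // scaler0 addr0.
Qed.

Lemma coset_arity n (x y : frak_a) : Fil n (x - y) ->
  Defs.coset (Fil n) x = Defs.coset (Fil n) y.
Proof.
have [_ hl] := arity_filtration_lin n; move=> xy; apply/seteqP; split=> z /= hz.
  have := hl 1 _ _ hz xy; rewrite scale1r addrA subrK; exact.
have := hl (-1) _ _ xy hz; rewrite scaleN1r opprB addrC addrA subrK; exact.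
Qed.

Lemma mem_coset_arity n (x : frak_a) : Defs.coset (Fil n) x x.
Proof. rewrite /Defs.coset /= subrr; exact: (proj1 (arity_filtration_lin n)). Qed.

Lemma arity_filtration_complete d : set_bij [set x : frak_a | homog d x]%classic
  (invlim Fil d) (fun x n => Defs.coset (Fil n.+1) x).
Proof.
split.
- move=> x hx; split=> n; first by exists x.
  by move=> y hy e s sn; apply: hy; apply: (ltn_trans sn).
- move=> x y _ _ xy; apply: gHom_ext => e s.
  (* Step [(size s).+1] is the first one whose elements vanish on lists as long as [s]. *)
  have : Defs.coset (Fil (size s).+1) x y.
    rewrite (congr1 (fun C => C (size s)) xy); exact: mem_coset_arity.
  move=> /(_ e s (ltnSn _)) /eqP.
  change ((y e s - x e s == 0) -> x e s = y e s).
  by rewrite subr_eq0 => /eqP.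
- move=> C [Crep Cdec].
  have /choice [x xP] : forall n, exists y : frak_a,
      homog d y /\ C n = Defs.coset (Fil n.+1) y.
    by move=> n; have [y hy Cy] := Crep n; exists y.
  have Cle m n : (m <= n)%N -> (C n `<=` C m)%classic.
    elim: n => [|n ih]; first by rewrite leqn0 => /eqP ->.
    rewrite leq_eqVlt => /orP[/eqP -> //|/ih h].
    exact: subset_trans (Cdec n) h.
  have xE m n e s : (size s <= m)%N -> (m <= n)%N -> x n e s = x m e s.
    move=> sm mn; have : C m (x n).
      by apply: (Cle _ _ mn); rewrite (proj2 (xP n)); apply: mem_coset_arity.
    rewrite (proj2 (xP m)) => /(_ e s sm) /eqP.
    change ((x n e s - x m e s == 0) -> x n e s = x m e s).
    by rewrite subr_eq0 => /eqP.
  (* The limit takes its value on lists of length [k] from the representative [x k]; by [xE] all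
     later representatives agree there. *)
  have tH : is_Hom d (fun s => x (size s) d s).
    split=> [|s1 s2 a u v|ds s hs].
    + by have [] := gHom_Hom (x 0%N) d.
    + by rewrite !size_cat /=; apply: gHom_multilin.
    + by have [_ _] := gHom_Hom (x (size s)) d; apply.
  exists (mkgHom (singleP tH)).
    by apply/gHom_homogP => e /negPf ed; rewrite /= /single ed.
  apply/funext => n; rewrite (proj2 (xP n)); apply: coset_arity => e s sn.
  change (single d (fun s => x (size s) d s) e s - x n e s = 0).
  rewrite /single; case: eqP => [->|/eqP ed].
    by rewrite (xE (size s) n) // subrr.
  by have [/gHom_homogP h _] := xP n; rewrite h // subrr.
Qed.

End Voronov.

Theorem theorem7p3 (K : fieldType) (charK : [pchar K] =i pred0)
  (A : gradedSpace K) (mu : seq A -> A) (Amu : is_Ainf1 mu)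
  (M : gradedSpace K) (eta : seq A -> M -> seq A -> M)
  (Meta : is_bimodule mu eta) :
  is_Linf1 (derived_bracket Amu Meta) /\
  is_weakly_filtered (derived_bracket Amu Meta) (@arity_filtration K A M).
Proof.
split.
  (* Voronov's construction for the multilinear maps on [A (+) M], with [triangle] as the
     square-zero element. *)
  apply: (derived_Linf (@bracket_linl _ _) (@bracket_linr _ _) (@bracket_homog _ _)
    (@bracket_anti _ _) (@bracket_leibniz _ _) (@incl_linear _ _ _)
    (@proj_linear _ _ _) (@incl_homog _ _ _) (@proj_homog _ _ _) (@Defs.inclK _ _ _)
    (@bracket_incl _ _ _) (@proj_bracket _ _ _) (triangle_homog Amu Meta)
    (bracket_triangle Amu Meta) (proj_triangle Amu Meta) charK).
split.
- by move=> n _; apply: arity_filtration_lin.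
- move=> n _ d x hx e s sn; rewrite /= /single; case: eqP => // _; exact: hx.
- by move=> n _ x hx e s sn; apply: hx; apply: ltnW.
(* Only the empty list has length below 1, and maps vanish there by convention. *)
- apply/seteqP; split=> // x _ e [|//] _.
  by have [] := gHom_Hom x e.
- by exists 1%N => // s _; apply: derived_bracket_arity.
- exact: arity_filtration_complete.
Qed.
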